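(* Let $R$ be a noetherian commutative ring and $A$ a Frobenius $R$-algebra. For an object $X$ in $\mathbf K(\mathrm{Proj}\,A,R)$ we have $X=0$ if and only if $X_{k(\mathfrak p)}=0$ in $\mathbf K(\mathrm{Proj}\,A_{k(\mathfrak p)})$ for all $\mathfrak p\in\mathrm{Spec}\,R$.
   Context: An $R$-algebra $A$ is a Frobenius $R$-algebra if it is finitely generated projective as an $R$-module and $\mathrm{add}\,\mathrm{Hom}_R(A,R)=\mathrm{add}\,A$ in the category of (left) $A$-modules, where $\mathrm{add}\,M$ denotes direct summands of finite direct sums of copies of $M$. For a ring $\Lambda$, $\mathbf K(\mathrm{Proj}\,\Lambda)$ is the homotopy category of unbounded complexes of projective $\Lambda$-modules; $X=0$ means $X$ is contractible. $\mathbf K(\mathrm{Proj}\,A,R)$ is the full subcategory of $\mathbf K(\mathrm{Proj}\,A)$ of complexes whose restriction to $R$ is $K$-projective, i.e. every chain map of complexes of $R$-modules from it to an acyclic complex is null-homotopic. For $\mathfrak p\in\mathrm{Spec}\,R$, $k(\mathfrak p)$ is the residue field at $\mathfrak p$ and $(-)_{k(\mathfrak p)}=-\otimes_Rk(\mathfrak p)$. *)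

(* Defs.v *)
From HB Require Import structures.
From mathcomp Require Import all_boot all_algebra.
From mathcomp Require Import generic_quotient ring_quotient fraction.
From mathcomp Require Import boolp.

Set Implicit Arguments.
Unset Strict Implicit.
Unset Printing Implicit Defensive.

Import GRing.Theory.

Local Open Scope ring_scope.
Local Open Scope quotient_scope.

(* Rings are [pzRingType]s throughout, so that the zero ring is allowed, both *)
(* as the base ring and as an algebra (for instance as a fibre [A (x) k(p)]). *)

Section Modules.
Variable S : pzRingType.
Implicit Types M N P : lmodType S.

Definition surjective (U V : Type) (f : U -> V) := forall y, exists x, f x = y.

Definition projective P :=
  forall (M N : lmodType S) (g : {linear M -> N}) (f : {linear P -> N}),
    surjective g -> exists h : {linear P -> M}, forall x, g (h x) = f x.

Definition fin_gen M :=
  exists (n : nat) (e : 'I_n -> M),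
    forall x, exists c : 'I_n -> S, x = \sum_i c i *: e i.

(* [N] is in add [M]. *)
Definition in_add M N :=
  exists (n : nat) (i : {linear N -> {ffun 'I_n -> M}})
         (r : {linear {ffun 'I_n -> M} -> N}), cancel i r.

End Modules.

Definition is_ideal (R : comPzRingType) (I : R -> Prop) :=
  [/\ I 0, forall x y, I x -> I y -> I (x + y) & forall a x, I x -> I (a * x)].

Definition noetherian (R : comPzRingType) :=
  forall I : R -> Prop, is_ideal I ->
    exists (n : nat) (e : 'I_n -> R),
      forall x, I x <-> exists c : 'I_n -> R, x = \sum_i c i * e i.

Record complex (S : pzRingType) := Complex {
  ob :> int -> lmodType S;
  diff : forall i, {linear ob i -> ob (i + 1)};
  diff_diff : forall i (x : ob i), diff (i + 1) (diff i x) = 0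
}.
Arguments diff {S} c i.

Section Complexes.
Variable S : pzRingType.
Implicit Types X Y : complex S.

Record chain_map X Y := ChainMap {
  cmap :> forall i, {linear X i -> Y i};
  cmap_diff : forall i (x : X i), cmap (i + 1) (diff X i x) = diff Y i (cmap i x)
}.

(* A homotopy has degree -1; the component [h i] starts in degree [i + 1], so *)
(* that no cast along [(i - 1) + 1 = i] is needed.                            *)
Definition null_homotopic X Y (f : forall i, {linear X i -> Y i}) :=
  exists h : forall i, {linear X (i + 1) -> Y i},
    forall i (x : X (i + 1)),
      f (i + 1) x = diff Y i (h i x) + h (i + 1) (diff X (i + 1) x).

Definition acyclic Y :=
  forall i (y : Y (i + 1)), diff Y (i + 1) y = 0 -> exists x, diff Y i x = y.

Definition K_projective X :=
  forall Y, acyclic Y -> forall f : chain_map X Y, null_homotopic f.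

Definition id_chain X : chain_map X X :=
  @ChainMap X X (fun i => idfun) (fun _ _ => erefl).

Definition contractible X := null_homotopic (id_chain X).

End Complexes.

(* Objects of the homotopy category K(Proj S); the zero ones are the           *)
(* contractible complexes.                                                    *)
Record KProj (S : pzRingType) := {
  KProj_complex :> complex S;
  KProj_projective : forall i, projective (KProj_complex i)
}.

Definition KProj_zero (S : pzRingType) (X : KProj S) := contractible X.

Definition restrict (S T : pzRingType) (phi : {rmorphism S -> T})
  (M : lmodType T) : Type := M.

Section Restriction.
Variables (S T : pzRingType) (phi : {rmorphism S -> T}).
Local Notation restrict := (restrict phi).

HB.instance Definition _ M := GRing.Zmodule.on (restrict M).

Section Module.
Variable M : lmodType T.
Definition restrict_scale (s : S) (x : restrict M) : restrict M :=
  phi s *: (x : M).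
Fact restrict_scaleA a b v :
  restrict_scale a (restrict_scale b v) = restrict_scale (a * b) v.
Proof. by rewrite /restrict_scale scalerA rmorphM. Qed.
Fact restrict_scale1 : left_id 1 restrict_scale.
Proof. by move=> v; rewrite /restrict_scale rmorph1 scale1r. Qed.
Fact restrict_scaleDr : right_distributive restrict_scale +%R.
Proof. by move=> a u v; rewrite /restrict_scale scalerDr. Qed.
Fact restrict_scaleDl v : {morph restrict_scale^~ v : a b / a + b}.
Proof. by move=> a b; rewrite /restrict_scale rmorphD scalerDl. Qed.
HB.instance Definition _ := GRing.Zmodule_isLmodule.Build S (restrict M)
  restrict_scaleA restrict_scale1 restrict_scaleDr restrict_scaleDl.
End Module.

Definition restrict_map (M N : lmodType T) (f : {linear M -> N})
  (x : restrict M) : restrict N := f x.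

Fact restrict_map_linear M N f : linear (@restrict_map M N f).
Proof. by move=> a x y; apply: linearP. Qed.

HB.instance Definition _ M N f :=
  GRing.isLinear.Build S (restrict M) (restrict N) *:%R (@restrict_map M N f)
    (@restrict_map_linear M N f).

Fact restrict_diff_diff (X : complex T) i (x : restrict (X i)) :
  restrict_map (diff X (i + 1)) (restrict_map (diff X i) x) = 0.
Proof. exact: diff_diff. Qed.

Definition restrict_complex (X : complex T) : complex S :=
  @Complex S (fun i => restrict (X i)) (fun i => restrict_map (diff X i))
    (@restrict_diff_diff X).

End Restriction.


(* The library's [algType R] is restricted to nonzero algebras. *)
Record algebra (R : comPzRingType) := Algebra {
  alg_ring :> pzRingType;
  alg_str : {rmorphism R -> alg_ring};
  alg_central : forall r (a : alg_ring), alg_str r * a = a * alg_str r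
}.

Section Frobenius.
Variables (R : comPzRingType) (A : algebra R).

Definition alg_mod : lmodType R := restrict (alg_str A) A^o.

(* Hom_R(A, R), with the left [A]-action [(a f) x = f (x a)]. *)
Definition dual : Type := {linear alg_mod -> R^o}.

Definition dual_fun (f : dual) : {linear alg_mod -> R^o} := f.

Lemma dual_ext (f g : dual) : dual_fun f =1 dual_fun g -> f = g.
Proof.
rewrite /dual_fun; case: f g => [f [c1 c2]] [g [c3 c4]] /= /funext fg.
case: _ / fg in c3 c4 *.
case: c1 c2 c3 c4 => [p1] [p2] [p3] [p4].
by rewrite (Prop_irrelevance p1 p3) (Prop_irrelevance p2 p4).
Qed.

HB.instance Definition _ := gen_eqMixin dual.
HB.instance Definition _ := gen_choiceMixin dual.

Definition dual_zero : dual := \0.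
Definition dual_add (f g : dual) : dual := dual_fun f \+ dual_fun g.
Definition dual_opp (f : dual) : dual := \- dual_fun f.

Fact dual_addA : associative dual_add.
Proof. by move=> f g h; apply: dual_ext => x /=; rewrite addrA. Qed.
Fact dual_addC : commutative dual_add.
Proof. by move=> f g; apply: dual_ext => x /=; rewrite addrC. Qed.
Fact dual_add0 : left_id dual_zero dual_add.
Proof. by move=> f; apply: dual_ext => x /=; rewrite add0r. Qed.
Fact dual_addN : left_inverse dual_zero dual_opp dual_add.
Proof. by move=> f; apply: dual_ext => x /=; rewrite addNr. Qed.

HB.instance Definition _ :=
  GRing.isZmodule.Build dual dual_addA dual_addC dual_add0 dual_addN.

Definition dual_scale_fun (a : A) (f : dual) (x : alg_mod) : R^o :=
  dual_fun f ((x : A) * a : A).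

Fact dual_scale_linear a f : linear (dual_scale_fun a f).
Proof.
move=> r x y; rewrite /dual_scale_fun -linearP; congr (dual_fun f _).
by rewrite [LHS]mulrDl /= -[in LHS]mulrA.
Qed.

HB.instance Definition _ a f :=
  GRing.isLinear.Build R alg_mod R^o *:%R (dual_scale_fun a f)
    (dual_scale_linear a f).

Definition dual_scale (a : A) (f : dual) : dual := dual_scale_fun a f.

Fact dual_scaleA a b f : dual_scale a (dual_scale b f) = dual_scale (a * b) f.
Proof.
by apply: dual_ext => x /=; rewrite /dual_scale_fun /= /dual_scale_fun mulrA.
Qed.
Fact dual_scale1 : left_id 1 dual_scale.
Proof. by move=> f; apply: dual_ext => x /=; rewrite /dual_scale_fun mulr1. Qed.
Fact dual_scaleDr : right_distributive dual_scale +%R.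
Proof. by move=> a f g; apply: dual_ext. Qed.
Fact dual_scaleDl f : {morph dual_scale^~ f : a b / a + b}.
Proof.
move=> a b; apply: dual_ext => x /=.
by rewrite /dual_scale_fun mulrDr; apply: raddfD.
Qed.

HB.instance Definition _ := GRing.Zmodule_isLmodule.Build A dual
  dual_scaleA dual_scale1 dual_scaleDr dual_scaleDl.

Definition frobenius :=
  [/\ fin_gen alg_mod, projective alg_mod &
      forall N : lmodType A, in_add dual N <-> in_add A^o N].

End Frobenius.

Section Tensor.
Variables (R : comPzRingType) (M N : lmodType R).

(* [tens M N] is the quotient of the formal sums of pure tensors (finite      *)
(* sequences, added by concatenation) by the congruence [tens_rel].           *)
Inductive tens_rel : seq (M * N) -> seq (M * N) -> Prop :=
| TensRefl s : tens_rel s s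
| TensSym s t : tens_rel s t -> tens_rel t s
| TensTrans t s u : tens_rel s t -> tens_rel t u -> tens_rel s u
| TensCat s s' t t' :
    tens_rel s s' -> tens_rel t t' -> tens_rel (s ++ t) (s' ++ t')
| TensComm s t : tens_rel (s ++ t) (t ++ s)
| TensAddl m m' n : tens_rel [:: (m + m', n)] [:: (m, n); (m', n)]
| TensAddr m n n' : tens_rel [:: (m, n + n')] [:: (m, n); (m, n')]
| TensBal r m n : tens_rel [:: (r *: m, n)] [:: (m, r *: n)]
| TensZero n : tens_rel [:: (0, n)] [::].

Definition tens_relb s t := `[< tens_rel s t >].

Fact tens_relb_equiv : equiv_class_of tens_relb.
Proof.
split.
- by move=> s; apply/asboolP/TensRefl.
- by move=> s t; apply/asboolP/asboolP => /TensSym.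
- move=> t s u /asboolP st /asboolP tu; apply/asboolP.
  exact: TensTrans st tu.
Qed.

Canonical tens_equiv := EquivRelPack tens_relb_equiv.
Canonical tens_enc := defaultEncModRel tens_relb.

Definition tens : Type := {eq_quot tens_equiv}.
HB.instance Definition _ := Choice.on tens.
HB.instance Definition _ : EqQuotient _ tens_equiv tens := EqQuotient.on tens.

Definition tens_pi (s : seq (M * N)) : tens := \pi_tens s.

Lemma tens_piP s t : tens_pi s = tens_pi t <-> tens_rel s t.
Proof.
rewrite /tens_pi; split => [/eqP|st].
  by rewrite piE => /asboolP.
by apply/eqP; rewrite piE; apply/asboolP.
Qed.

Lemma tens_repr (x : tens) : tens_pi (repr x) = x.
Proof. exact: reprK. Qed.

Definition tens_opp_seq (s : seq (M * N)) := [seq (- p.1, p.2) | p <- s].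
Definition tens_zero := tens_pi [::].
Definition tens_add (x y : tens) : tens := tens_pi (repr x ++ repr y).
Definition tens_opp (x : tens) : tens := tens_pi (tens_opp_seq (repr x)).

Lemma tens_pi_cat s t : tens_pi (s ++ t) = tens_add (tens_pi s) (tens_pi t).
Proof.
by apply/tens_piP/TensCat; apply/tens_piP; rewrite tens_repr.
Qed.

Fact tens_addA : associative tens_add.
Proof.
move=> x y z; rewrite -[x]tens_repr -[y]tens_repr -[z]tens_repr.
by rewrite -!tens_pi_cat catA.
Qed.
Fact tens_addC : commutative tens_add.
Proof.
move=> x y; rewrite -[x]tens_repr -[y]tens_repr -!tens_pi_cat.
exact/tens_piP/TensComm.
Qed.
Fact tens_add0 : left_id tens_zero tens_add.
Proof. by move=> x; rewrite -[x]tens_repr -tens_pi_cat. Qed.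
Fact tens_addN : left_inverse tens_zero tens_opp tens_add.
Proof.
move=> x; rewrite -{2}[x]tens_repr -tens_pi_cat; move: (repr x) => {x} s.
elim: s => // -[m n] s IHs.
rewrite -[in RHS]IHs [tens_opp_seq _]/= -[(m, n) :: s]cat1s.
rewrite -cat1s -catA (tens_pi_cat [:: _]) (tens_pi_cat _ ([:: _] ++ s)).
rewrite (tens_pi_cat [:: (m, n)]) [X in tens_add _ X]tens_addA.
rewrite [X in tens_add _ (tens_add X _)]tens_addC -tens_addA tens_addA.
rewrite -!tens_pi_cat -[RHS]/(tens_pi ([::] ++ _)) tens_pi_cat [RHS]tens_pi_cat.
congr tens_add; apply/tens_piP; apply: TensTrans (TensZero n).
by apply: TensSym; rewrite -{1}(addNr m); apply: TensAddl.
Qed.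

HB.instance Definition _ :=
  GRing.isZmodule.Build tens tens_addA tens_addC tens_add0 tens_addN.

Definition pure (m : M) (n : N) : tens := tens_pi [:: (m, n)].

Record balanced (Z : zmodType) (f : M -> N -> Z) : Prop := Balanced {
  balancedDl : forall m m' n, f (m + m') n = f m n + f m' n;
  balancedDr : forall m n n', f m (n + n') = f m n + f m n';
  balancedZ : forall r m n, f (r *: m) n = f m (r *: n)
}.

Lemma pure_balanced : balanced pure.
Proof.
split=> [m m' n|m n n'|r m n].
- by rewrite [RHS]/GRing.add /= -tens_pi_cat; apply/tens_piP/TensAddl.
- by rewrite [RHS]/GRing.add /= -tens_pi_cat; apply/tens_piP/TensAddr.
- exact/tens_piP/TensBal.
Qed.

Lemma tens_ind (P : tens -> Prop) :
  P 0 -> (forall m n, P (pure m n)) -> (forall x y, P x -> P y -> P (x + y)) ->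
  forall x, P x.
Proof.
move=> P0 Ppure Padd x; rewrite -[x]tens_repr; elim: (repr x) => // -[m n] s IHs.
by rewrite -cat1s tens_pi_cat; exact: Padd (Ppure m n) IHs.
Qed.

Definition tens_lift (Z : zmodType) (f : M -> N -> Z) (x : tens) : Z :=
  \sum_(p <- repr x) f p.1 p.2.

Section Lift.
Variables (Z : zmodType) (f : M -> N -> Z).
Hypothesis fP : balanced f.

Lemma tens_lift_pi s : tens_lift f (tens_pi s) = \sum_(p <- s) f p.1 p.2.
Proof.
have f0 n : f 0 n = 0 by apply: (addrI (f 0 n)); rewrite -balancedDl ?addr0.
suff liftP s1 s2 : tens_rel s1 s2 ->
    \sum_(p <- s1) f p.1 p.2 = \sum_(p <- s2) f p.1 p.2.
  by apply/liftP/tens_piP; rewrite tens_repr.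
elim=> {s s1 s2} [//|s t _ -> //|t s u _ -> _ -> //|s s' t t' _ + _ +|s t|||| n].
- by rewrite !big_cat /= => -> ->.
- by rewrite !big_cat /= addrC.
- by move=> m m' n; rewrite !big_cons big_nil /= !addr0 balancedDl.
- by move=> m n n'; rewrite !big_cons big_nil /= !addr0 balancedDr.
- by move=> r m n; rewrite !big_cons big_nil /= !addr0 balancedZ.
- by rewrite big_cons big_nil /= addr0 f0.
Qed.

Lemma tens_lift_pure m n : tens_lift f (pure m n) = f m n.
Proof. by rewrite tens_lift_pi big_cons big_nil addr0. Qed.

Lemma tens_liftD : {morph tens_lift f : x y / x + y}.
Proof.
move=> x y; rewrite -[x]tens_repr -[y]tens_repr [in LHS]/GRing.add /=.
by rewrite -tens_pi_cat !tens_lift_pi big_cat.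
Qed.

Lemma tens_lift0 : tens_lift f 0 = 0.
Proof. by apply: (addrI (tens_lift f 0)); rewrite -tens_liftD !addr0. Qed.

End Lift.
End Tensor.

Section TensorAction.
Variables (R : comPzRingType) (A B : algebra R).

(* [M (x)_R N] for an [A]-module [M] and a [B]-module [N], as a left module   *)
(* over the ring [A (x)_R B].                                                 *)
Definition tens_mod (M : lmodType A) (N : lmodType B) : Type :=
  tens (restrict (alg_str A) M) (restrict (alg_str B) N).
HB.instance Definition _ M N := GRing.Zmodule.on (tens_mod M N).

Definition tens_alg : Type := tens_mod A^o B^o.
HB.instance Definition _ := GRing.Zmodule.on tens_alg.

Section Scale.
Variables (M : lmodType A) (N : lmodType B).

Definition tpure (m : M) (n : N) : tens_mod M N :=
  @pure R (restrict (alg_str A) M) (restrict (alg_str B) N) m n.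

Lemma tpureDl m m' n : tpure (m + m') n = tpure m n + tpure m' n.
Proof. exact: balancedDl (pure_balanced _ _) _ _ _. Qed.
Lemma tpureDr m n n' : tpure m (n + n') = tpure m n + tpure m n'.
Proof. exact: balancedDr (pure_balanced _ _) _ _ _. Qed.
Lemma tpureZ r m n :
  tpure (alg_str A r *: m) n = tpure m (alg_str B r *: n).
Proof. exact: balancedZ (pure_balanced _ _) _ _ _. Qed.

Lemma tpure_ind (P : tens_mod M N -> Prop) :
  P 0 -> (forall m n, P (tpure m n)) ->
  (forall x y, P x -> P y -> P (x + y)) -> forall x, P x.
Proof.
by move=> P0 Ppure Padd x; exact: (@tens_ind R _ _ P P0 Ppure Padd x).
Qed.

Definition tlift (Z : zmodType) (f : M -> N -> Z) (x : tens_mod M N) : Z :=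
  @tens_lift R (restrict (alg_str A) M) (restrict (alg_str B) N) Z f x.

Definition tbalanced (Z : zmodType) (f : M -> N -> Z) :=
  @balanced R (restrict (alg_str A) M) (restrict (alg_str B) N) Z f.

Lemma tlift_pure (Z : zmodType) (f : M -> N -> Z) m n :
  tbalanced f -> tlift f (tpure m n) = f m n.
Proof. by move=> fP; exact: tens_lift_pure fP m n. Qed.

Lemma tliftD (Z : zmodType) (f : M -> N -> Z) x y :
  tbalanced f -> tlift f (x + y) = tlift f x + tlift f y.
Proof. by move=> fP; exact: tens_liftD fP x y. Qed.

Lemma tlift0 (Z : zmodType) (f : M -> N -> Z) : tbalanced f -> tlift f 0 = 0.
Proof. by move=> fP; exact: tens_lift0 fP. Qed.

Definition tact (a : A) (b : B) (t : tens_mod M N) : tens_mod M N :=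
  tlift (fun m n => tpure (a *: m) (b *: n)) t.

Lemma tact_balanced a b : tbalanced (fun m n => tpure (a *: m) (b *: n)).
Proof.
split=> [m m' n|m n n'|r m n].
- by rewrite -tpureDl -scalerDr.
- by rewrite -tpureDr -scalerDr.
- have -> : a *: ((r *: m : restrict (alg_str A) M) : M)
          = alg_str A r *: (a *: (m : M)).
    by rewrite [r *: m]/(alg_str A r *: (m : M)) !scalerA alg_central.
  rewrite tpureZ; congr tpure.
  by rewrite [in RHS]/(r *: n) /= !scalerA alg_central.
Qed.

Lemma tact_pure a b m n : tact a b (tpure m n) = tpure (a *: m) (b *: n).
Proof. exact/tlift_pure/tact_balanced. Qed.
Lemma tactD a b x y : tact a b (x + y) = tact a b x + tact a b y.
Proof. exact/tliftD/tact_balanced. Qed.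
Lemma tact0 a b : tact a b 0 = 0.
Proof. exact/tlift0/tact_balanced. Qed.

Definition tens_scale (u : tens_alg) (t : tens_mod M N) : tens_mod M N :=
  @tens_lift R (restrict (alg_str A) A^o) (restrict (alg_str B) B^o) _
    (fun a b => tact a b t) u.

Lemma tens_scale_balanced t :
  @balanced R (restrict (alg_str A) A^o) (restrict (alg_str B) B^o) _
    (fun a b => tact a b t).
Proof.
split=> [a a' b|a b b'|r a b]; elim/tpure_ind: t => [|m n|x y IHx IHy].
all: rewrite ?tact0 ?addr0 ?tact_pure ?tactD //.
- by rewrite -tpureDl -scalerDl.
- by rewrite IHx IHy addrACA.
- by rewrite -tpureDr -scalerDl.
- by rewrite IHx IHy addrACA.
- rewrite [r *: a]/(alg_str A r * (a : A)) [r *: b]/(alg_str B r * (b : B)).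
  by rewrite -!scalerA tpureZ.
- by rewrite IHx IHy.
Qed.

Lemma tens_scaleDr u x y : tens_scale u (x + y) = tens_scale u x + tens_scale u y.
Proof.
elim/tens_ind: u => [|a b|u v IHu IHv].
- by rewrite /tens_scale !tens_lift0 ?addr0 //; apply: tens_scale_balanced.
- by rewrite /tens_scale !tens_lift_pure ?tactD //; apply: tens_scale_balanced.
rewrite /tens_scale in IHu IHv *; rewrite !tens_liftD; first last.
all: try exact: tens_scale_balanced.
by rewrite IHu IHv addrACA.
Qed.

Lemma tens_scaleDl u v t : tens_scale (u + v) t = tens_scale u t + tens_scale v t.
Proof. by rewrite /tens_scale tens_liftD //; apply: tens_scale_balanced. Qed.

Lemma tens_scale0l t : tens_scale 0 t = 0.
Proof. by rewrite /tens_scale tens_lift0 //; apply: tens_scale_balanced. Qed.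

Lemma tens_scale0r u : tens_scale u 0 = 0.
Proof. by apply: (addrI (tens_scale u 0)); rewrite -tens_scaleDr !addr0. Qed.

End Scale.

Definition apure (a : A) (b : B) : tens_alg := tpure (a : A^o) (b : B^o).

Section ScaleTheory.
Variables (M : lmodType A) (N : lmodType B).
Implicit Types (t : tens_mod M N) (u v : tens_alg).

Lemma tens_scale_apure a b t : tens_scale (apure a b) t = tact a b t.
Proof. by rewrite /tens_scale tens_lift_pure //; apply: tens_scale_balanced. Qed.

Lemma tens_scale_pure a b (m : M) (n : N) :
  tens_scale (apure a b) (tpure m n) = tpure (a *: m) (b *: n).
Proof. by rewrite tens_scale_apure tact_pure. Qed.

Lemma apure_ind (P : tens_alg -> Prop) :
  P 0 -> (forall a b, P (apure a b)) ->
  (forall x y, P x -> P y -> P (x + y)) -> forall x, P x.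
Proof.
by move=> P0 Ppure Padd x; exact: (@tens_ind R _ _ P P0 Ppure Padd x).
Qed.

Lemma tens_scale_apure2 a b a' b' :
  tens_scale (apure a b) (apure a' b' : tens_mod A^o B^o)
  = apure (a * a') (b * b').
Proof.
rewrite /tens_scale tens_lift_pure ?[LHS]tact_pure //.
exact: tens_scale_balanced.
Qed.

Lemma tens_scaleA u v t :
  tens_scale u (tens_scale v t) = tens_scale (tens_scale u v : tens_alg) t.
Proof.
elim/apure_ind: u => [|a b|u u' IHu IHu'].
- by rewrite !tens_scale0l.
- elim/apure_ind: v => [|c d|v v' IHv IHv'].
  + by rewrite tens_scale0l !tens_scale0r tens_scale0l.
  + rewrite tens_scale_apure2.
    elim/tpure_ind: t => [|m n|x y IHx IHy].
    * by rewrite !tens_scale0r.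
    * by rewrite !tens_scale_pure !scalerA.
    * by rewrite !tens_scaleDr IHx IHy.
  + by rewrite tens_scaleDl !tens_scaleDr tens_scaleDl IHv IHv'.
- by rewrite !tens_scaleDl IHu IHu'.
Qed.

Lemma tens_scale1 t : tens_scale (apure 1 1) t = t.
Proof.
elim/tpure_ind: t => [|m n|x y IHx IHy].
- by rewrite tens_scale0r.
- by rewrite tens_scale_pure !scale1r.
- by rewrite tens_scaleDr IHx IHy.
Qed.

End ScaleTheory.

Definition tens_mul (u v : tens_alg) : tens_alg := tens_scale u v.

Fact tens_mulA : associative tens_mul.
Proof. by move=> u v w; apply: tens_scaleA. Qed.
Fact tens_mul1l : left_id (apure 1 1) tens_mul.
Proof. by move=> u; apply: tens_scale1. Qed.
Fact tens_mul1r : right_id (apure 1 1) tens_mul.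
Proof.
move=> u; rewrite /tens_mul; elim/apure_ind: u => [|a b|u v IHu IHv].
- exact: tens_scale0l.
- rewrite [LHS]tens_scale_pure /apure; congr tpure; exact: mulr1.
- by rewrite [LHS]tens_scaleDl; congr (_ + _).
Qed.
Fact tens_mulDl : left_distributive tens_mul +%R.
Proof. by move=> u v w; apply: tens_scaleDl. Qed.
Fact tens_mulDr : right_distributive tens_mul +%R.
Proof. by move=> u v w; apply: tens_scaleDr. Qed.

HB.instance Definition _ := GRing.Zmodule_isPzRing.Build tens_alg
  tens_mulA tens_mul1l tens_mul1r tens_mulDl tens_mulDr.

Lemma apureM a b a' b' : apure a b * apure a' b' = apure (a * a') (b * b').
Proof. exact: tens_scale_pure. Qed.

Section Lmodule.
Variables (M : lmodType A) (N : lmodType B).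
Fact tens_scaleDl_morph (v : tens_mod M N) :
  {morph (@tens_scale M N)^~ v : a b / a + b}.
Proof. by move=> a b; apply: tens_scaleDl. Qed.
HB.instance Definition _ := GRing.Zmodule_isLmodule.Build
  tens_alg (tens_mod M N)
  (@tens_scaleA M N) (@tens_scale1 M N) (@tens_scaleDr M N) tens_scaleDl_morph.

Lemma apureZ a b (m : M) (n : N) :
  apure a b *: tpure m n = tpure (a *: m) (b *: n).
Proof. exact: tens_scale_pure. Qed.
End Lmodule.

Definition tens_map (M M' : lmodType A) (N : lmodType B) (f : {linear M -> M'})
    (x : tens_mod M N) : tens_mod M' N :=
  tlift (fun m n => tpure (f m) n) x.

Section TensMap.
Variables (M M' : lmodType A) (N : lmodType B) (f : {linear M -> M'}).

Lemma tens_map_balanced :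
  tbalanced (fun (m : M) (n : N) => tpure (f m) n).
Proof.
split=> [m m' n|m n n'|r m n].
- by rewrite -tpureDl -raddfD.
- by rewrite -tpureDr.
- by rewrite [r *: m]/(alg_str A r *: (m : M)) linearZ tpureZ.
Qed.

Lemma tens_map_pure m n : tens_map f (tpure m n) = tpure (f m) n :> tens_mod M' N.
Proof. exact/tlift_pure/tens_map_balanced. Qed.

Fact tens_map_linear : linear (@tens_map M M' N f).
Proof.
move=> u x y; rewrite [LHS]tliftD; last exact: tens_map_balanced.
congr (_ + _); rewrite -![tlift _ _]/(tens_map f _).
elim/apure_ind: u => [|a b|u v IHu IHv].
- by rewrite !scale0r; apply/tlift0/tens_map_balanced.
- elim/tpure_ind: x => [|m n|x x' IHx IHx'].
  + by rewrite [tens_map f 0]tlift0 ?scaler0 ?[LHS]tlift0 //; apply: tens_map_balanced.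
  + by rewrite apureZ !tens_map_pure apureZ linearZ.
  + rewrite scalerDr /tens_map !tliftD ?scalerDr; first last.
    all: try exact: tens_map_balanced.
    by congr (_ + _).
- rewrite scalerDl [LHS]tliftD; last exact: tens_map_balanced.
  by rewrite scalerDl; congr (_ + _).
Qed.
HB.instance Definition _ :=
  GRing.isLinear.Build tens_alg (tens_mod M N) (tens_mod M' N) *:%R
    (@tens_map M M' N f) tens_map_linear.
End TensMap.

End TensorAction.

Section BaseChange.
Variables (R : comPzRingType) (A B : algebra R).

Definition base_change (M : lmodType A) : lmodType (tens_alg A B) :=
  tens_mod M B^o.

Fact base_change_diff_diff (X : complex A) i (x : base_change (X i)) :
  tens_map (diff X (i + 1)) (tens_map (diff X i) x) = 0 :> base_change _.
Proof.
elim/tpure_ind: x => [|m n|x y IHx IHy].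
- by rewrite !raddf0.
- rewrite !tens_map_pure diff_diff.
  by apply: (addrI (tpure 0 n)); rewrite -tpureDl !addr0.
- by rewrite !raddfD -[RHS]addr0; congr (_ + _).
Qed.

Definition base_change_complex (X : complex A) : complex (tens_alg A B) :=
  @Complex (tens_alg A B) (fun i => base_change (X i))
    (fun i => tens_map (diff X i)) (@base_change_diff_diff X).

Definition base_change_incl (a : A) : tens_alg A B := apure a 1.

Fact base_change_incl_zmod : zmod_morphism base_change_incl.
Proof.
move=> a b; apply/eqP; rewrite -subr_eq opprK; apply/eqP.
by rewrite -[LHS]tpureDl subrK.
Qed.
Fact base_change_incl_monoid : monoid_morphism base_change_incl.
Proof. by split=> // a b; rewrite [RHS]apureM mulr1. Qed.
HB.instance Definition _ :=
  GRing.isZmodMorphism.Build A (tens_alg A B) base_change_incl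
    base_change_incl_zmod.
HB.instance Definition _ :=
  GRing.isMonoidMorphism.Build A (tens_alg A B) base_change_incl
    base_change_incl_monoid.

Section Projective.
Variables (P : lmodType A) (L : lmodType (tens_alg A B)).
Variable f : {linear base_change P -> L}.

Definition base_change_unit (p : P) : restrict base_change_incl L :=
  f (tpure p (1 : B^o)).

Fact base_change_unit_linear : linear base_change_unit.
Proof.
move=> a p q; rewrite /base_change_unit tpureDl raddfD; congr (_ + _).
transitivity (f (apure a 1 *: (tpure p (1 : B^o) : base_change P))).
  by congr (f _); rewrite [RHS]apureZ scale1r.
exact: linearZ.
Qed.
HB.instance Definition _ := GRing.isLinear.Build A P
  (restrict base_change_incl L) *:%R base_change_unit base_change_unit_linear.

Variables (M : lmodType (tens_alg A B)) (h : {linear P -> restrict base_change_incl M}).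

Definition base_change_adj (x : base_change P) : M :=
  tlift (fun (p : P) (b : B^o) => apure 1 b *: (h p : M)) x.

Lemma base_change_adj_balanced :
  tbalanced (fun (p : P) (b : B^o) => apure 1 b *: (h p : M)).
Proof.
split=> [p q b|p b c|r p b].
- by rewrite -scalerDr -raddfD.
- by rewrite -scalerDl -[apure 1 b + _]tpureDr.
- rewrite [r *: p]/(alg_str A r *: (p : P)) linearZ /=.
  rewrite [_ *: h p]/(apure (alg_str A r) 1 *: (h p : M)) scalerA apureM.
  rewrite mul1r mulr1 -[alg_str A r]mulr1; congr (_ *: _).
  exact: (@tpureZ R A B A^o B^o r 1 b).
Qed.

Fact base_change_adj_linear : linear base_change_adj.
Proof.
move=> u x y; rewrite [LHS]tliftD; last exact: base_change_adj_balanced.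
congr (_ + _); rewrite -![tlift _ _]/(base_change_adj _).
have adjD v w : base_change_adj (v + w) = base_change_adj v + base_change_adj w.
  exact/tliftD/base_change_adj_balanced.
have adj0 : base_change_adj 0 = 0 by exact/tlift0/base_change_adj_balanced.
elim/apure_ind: u => [|a b|u v IHu IHv].
- by rewrite !scale0r.
- elim/tpure_ind: x => [|p c|x x' IHx IHx'].
  + by rewrite adj0 !scaler0.
  + rewrite apureZ /base_change_adj !tlift_pure ?linearZ /=.
    all: try exact: base_change_adj_balanced.
    rewrite [_ *: h p]/(apure a 1 *: (h p : M)) !scalerA !apureM.
    by rewrite mul1r !mulr1.
  + by rewrite scalerDr !adjD IHx IHx' scalerDr.
- by rewrite !scalerDl adjD IHu IHv.
Qed.
HB.instance Definition _ := GRing.isLinear.Build (tens_alg A B)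
  (base_change P) M *:%R base_change_adj base_change_adj_linear.

End Projective.

Lemma base_change_projective (P : lmodType A) :
  projective P -> projective (base_change P).
Proof.
move=> Pproj M L g f g_surj.
have [h hP] := Pproj (restrict base_change_incl M) (restrict base_change_incl L)
  (restrict_map g) (base_change_unit f) g_surj.
exists (base_change_adj h); elim/tpure_ind => [|p b|x y IHx IHy].
- by rewrite !raddf0.
- transitivity (g (apure 1 b *: (h p : M))).
    by congr (g _); apply/tlift_pure/base_change_adj_balanced.
  rewrite linearZ /= [g _]hP.
  transitivity (f (apure 1 b *: (tpure p (1 : B^o) : base_change P))).
    by rewrite linearZ.
  by congr (f _); rewrite [LHS]apureZ scale1r [b *: _]mulr1.
- by rewrite !raddfD; congr (_ + _).
Qed.

Definition base_change_KProj (X : KProj A) : KProj (tens_alg A B) :=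
  {| KProj_complex := base_change_complex X;
     KProj_projective := fun i => base_change_projective (@KProj_projective _ X i) |}.

End BaseChange.

(* The points of Spec R. As for the library's [prime_idealr], the prime ideal *)
(* is a boolean predicate; by classical logic every subset is one.            *)
Record spec (R : comPzRingType) := Spec {
  spec_pred :> {pred R};
  spec0 : 0 \in spec_pred;
  specD : forall x y, x \in spec_pred -> y \in spec_pred -> x + y \in spec_pred;
  specMl : forall a x, x \in spec_pred -> a * x \in spec_pred;
  spec1 : 1 \notin spec_pred;
  specM : forall x y, x * y \in spec_pred -> (x \in spec_pred) || (y \in spec_pred)
}.

Section ResidueField.
Variables (R : comPzRingType) (p : spec R).

(* [R], seen as a nonzero ring because it has the prime ideal [p]. *)
Definition spec_ring of spec R : Type := R.
Local Notation Rp := (spec_ring p).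

HB.instance Definition _ := GRing.ComPzRing.on Rp.

Fact spec_ring_neq0 : (1 : Rp) != 0.
Proof.
by apply: contraNneq (spec1 p) => eq10; rewrite [1]eq10; apply: spec0.
Qed.
HB.instance Definition _ := GRing.PzSemiRing_isNonZero.Build Rp spec_ring_neq0.

Definition spec_ideal (x : Rp) : bool := (x : R) \in p.

Fact spec_idealr_closed : idealr_closed spec_ideal.
Proof.
split; [exact: spec0 | exact: spec1 | move=> a x y xp yp].
by apply: (@specD R p) => //; apply: (@specMl R p).
Qed.
HB.instance Definition _ := isIdealr.Build Rp spec_ideal spec_idealr_closed.

Fact spec_prime : prime_idealr_closed spec_ideal.
Proof. by move=> x y; apply: (@specM R p). Qed.
HB.instance Definition _ := isPrimeIdealrClosed.Build Rp spec_ideal spec_prime.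

Definition spec_prime_idealr : prime_idealr Rp := spec_ideal.

Definition spec_quot : Type := {ideal_quot spec_prime_idealr}.
HB.instance Definition _ := GRing.ComNzRing.on spec_quot.

Definition spec_quot_unit : {pred spec_quot} := fun x => `[< exists y, y * x = 1 >].
Definition spec_quot_inv (x : spec_quot) : spec_quot :=
  if pselect (exists y, y * x = 1) is left ex then projT1 (cid ex) else x.

Fact spec_quot_mulVx : {in spec_quot_unit, left_inverse 1 spec_quot_inv *%R}.
Proof.
move=> x /asboolP ux; rewrite /spec_quot_inv.
by case: pselect => // ex; case: cid.
Qed.
Fact spec_quot_unitPl x y : y * x = 1 -> spec_quot_unit x.
Proof. by move=> yx; apply/asboolP; exists y. Qed.
Fact spec_quot_invr_out : {in [predC spec_quot_unit], spec_quot_inv =1 id}.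
Proof.
move=> x /asboolP ux; rewrite /spec_quot_inv.
by case: pselect.
Qed.
HB.instance Definition _ := GRing.ComNzRing_hasMulInverse.Build spec_quot
  spec_quot_mulVx spec_quot_unitPl spec_quot_invr_out.

Fact spec_quot_domain : GRing.integral_domain_axiom spec_quot.
Proof. by move=> x y; apply: Quotient.rquot_IdomainAxiom. Qed.
HB.instance Definition _ :=
  GRing.ComUnitRing_isIntegral.Build spec_quot spec_quot_domain.

(* k(p), as the fraction field of R/p. *)
Definition residue_field : fieldType := {fraction spec_quot}.

Definition to_residue_field (r : R) : residue_field :=
  tofrac (\pi_{ideal_quot spec_prime_idealr} (r : Rp) : spec_quot).

Fact to_residue_field_zmod : zmod_morphism to_residue_field.
Proof. 
move=> x y; rewrite -rmorphB /=; congr tofrac.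
exact: (rmorphB (\pi_{ideal_quot spec_prime_idealr})).
Qed.
Fact to_residue_field_monoid : monoid_morphism to_residue_field.
Proof.
by split=> [|x y]; rewrite /to_residue_field ?(rmorph1, rmorphM).
Qed.
HB.instance Definition _ :=
  GRing.isZmodMorphism.Build R residue_field to_residue_field
    to_residue_field_zmod.
HB.instance Definition _ :=
  GRing.isMonoidMorphism.Build R residue_field to_residue_field
    to_residue_field_monoid.

Definition residue_alg : algebra R :=
  @Algebra R residue_field to_residue_field (fun _ _ => mulrC _ _).

End ResidueField.

(* The objects of K(Proj A, R) among those of K(Proj A). *)
Definition in_KProj_rel (R : comPzRingType) (A : algebra R) (X : KProj A) :=
  K_projective (restrict_complex (alg_str A) X).

(* Main.v *)
(* Suppose all fibres X_k(p) are contractible.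

   First, N (x)_A X is acyclic for every right A-module N, by noetherian
   induction on the annihilator I of N in R. If rs lies in I but neither r nor s
   does, use the submodule rN and its quotient N/rN. If I is a prime p, then
   every r outside p acts invertibly on the homology of N (x)_A X, because the
   kernel and the cokernel of r on N have larger annihilators; and the
   contraction of X_k(p) shows that each homology class is killed by some such
   r. For flatness it is enough to take for N the quotients U/V of right ideals
   V <= U of A, and since X is a direct summand of a free module, N (x)_A X can
   be read off from coordinates.

   So X is acyclic with flat cycles, and such a complex of projectives is
   contractible (Benson-Goodearl, Neeman). Indeed every finite part of X is
   contracted by some map; local contractions can be corrected by null
   homotopies so as to agree, which contracts a countably generated subcomplex,
   and Zorn's lemma passes from there to X, the quotient by a contracted
   subcomplex being again acyclic with flat cycles.

   Gradings are dropped: X is a retract of the free module L on all its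
   homogeneous elements, and d, p : L -> L are its differential and the
   projection of L onto it. *)
Require Import Defs.
From HB Require Import structures.
From mathcomp Require Import all_boot all_algebra.
From mathcomp Require Import generic_quotient ring_quotient fraction.
From mathcomp Require Import boolp classical_sets.

Set Implicit Arguments.
Unset Strict Implicit.
Unset Printing Implicit Defensive.

Import GRing.Theory.
Local Open Scope ring_scope.
Local Open Scope quotient_scope.

(** * Free modules *)

Section FreeModuleType.
Variables (A : pzRingType) (B : choiceType).

Record free_module_type := Free {
  coord :> B -> A;
  coord_fin : exists s : seq B, forall b, b \notin s -> coord b = 0
}.

Lemma free_ext (x y : free_module_type) : (forall b, x b = y b) -> x = y.
Proof.
case: x y => [f fP] [g gP] /= /funext fg; subst g.
by rewrite (Prop_irrelevance fP gP).
Qed.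

HB.instance Definition _ := gen_eqMixin free_module_type.
HB.instance Definition _ := gen_choiceMixin free_module_type.

Fact free_zero_fin : exists s : seq B, forall b, b \notin s -> 0 = 0 :> A.
Proof. by exists [::]. Qed.
Definition free_zero := Free free_zero_fin.

Fact free_add_fin (x y : free_module_type) :
  exists s : seq B, forall b, b \notin s -> x b + y b = 0.
Proof.
case: (coord_fin x) (coord_fin y) => [s sP] [t tP]; exists (s ++ t) => b.
by rewrite mem_cat negb_or => /andP[/sP -> /tP ->]; rewrite addr0.
Qed.
Definition free_add x y := Free (free_add_fin x y).

Fact free_opp_fin (x : free_module_type) :
  exists s : seq B, forall b, b \notin s -> - x b = 0.
Proof. by case: (coord_fin x) => s sP; exists s => b /sP ->; rewrite oppr0. Qed.
Definition free_opp x := Free (free_opp_fin x).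

Fact free_scale_fin a (x : free_module_type) :
  exists s : seq B, forall b, b \notin s -> a * x b = 0.
Proof. by case: (coord_fin x) => s sP; exists s => b /sP ->; rewrite mulr0. Qed.
Definition free_scale a x := Free (free_scale_fin a x).

Fact free_addA : associative free_add.
Proof. by move=> x y z; apply: free_ext => b /=; rewrite addrA. Qed.
Fact free_addC : commutative free_add.
Proof. by move=> x y; apply: free_ext => b /=; rewrite addrC. Qed.
Fact free_add0 : left_id free_zero free_add.
Proof. by move=> x; apply: free_ext => b /=; rewrite add0r. Qed.
Fact free_addN : left_inverse free_zero free_opp free_add.
Proof. by move=> x; apply: free_ext => b /=; rewrite addNr. Qed.
HB.instance Definition _ :=
  GRing.isZmodule.Build free_module_type
    free_addA free_addC free_add0 free_addN.

Fact free_scaleA a b v : free_scale a (free_scale b v) = free_scale (a * b) v.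
Proof. by apply: free_ext => c /=; rewrite mulrA. Qed.
Fact free_scale1 : left_id 1 free_scale.
Proof. by move=> v; apply: free_ext => c /=; rewrite mul1r. Qed.
Fact free_scaleDr : right_distributive free_scale +%R.
Proof. by move=> a u v; apply: free_ext => c /=; rewrite mulrDr. Qed.
Fact free_scaleDl v : {morph free_scale^~ v : a b / a + b}.
Proof. by move=> a b; apply: free_ext => c /=; rewrite mulrDl. Qed.
HB.instance Definition _ := GRing.Zmodule_isLmodule.Build A free_module_type
  free_scaleA free_scale1 free_scaleDr free_scaleDl.

End FreeModuleType.

Section FreeModule.
Variables (A : pzRingType) (B : choiceType).

Definition free_module : lmodType A := free_module_type A B.
Definition fcoef (x : free_module) (b : B) : A :=
  coord (x : free_module_type A B) b.

Implicit Types (x y : free_module) (b c : B) (s t : seq B) (S T : B -> Prop).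

Lemma fcoef_ext x y : (forall b, fcoef x b = fcoef y b) -> x = y.
Proof. exact: free_ext. Qed.
Lemma fcoef0 b : fcoef 0 b = 0. Proof. by []. Qed.
Lemma fcoefD x y b : fcoef (x + y) b = fcoef x b + fcoef y b. Proof. by []. Qed.
Lemma fcoefN x b : fcoef (- x) b = - fcoef x b. Proof. by []. Qed.
Lemma fcoefZ a x b : fcoef (a *: x) b = a * fcoef x b. Proof. by []. Qed.

Lemma fcoef_sum (I : Type) (r : seq I) (F : I -> free_module) b :
  fcoef (\sum_(i <- r) F i) b = \sum_(i <- r) fcoef (F i) b.
Proof. by elim/big_rec2: _ => // i u v _ <-. Qed.

Fact delta_fin b : exists s, forall c, c \notin s -> (c == b)%:R = 0 :> A.
Proof. by exists [:: b] => c; rewrite inE => /negPf ->. Qed.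
Definition delta b : free_module := Free (delta_fin b).

(** A chosen duplicate-free list outside which [x] vanishes; it may also contain basis elements with
    coefficient 0. *)
Definition supp x : seq B :=
  undup (projT1 (cid (coord_fin (x : free_module_type A B)))).

Lemma supp_uniq x : uniq (supp x). Proof. exact: undup_uniq. Qed.
Lemma notin_supp x b : b \notin supp x -> fcoef x b = 0.
Proof. by rewrite /supp mem_undup; case: cid => s /= sP /sP. Qed.

Lemma free_sum x s : uniq s -> (forall b, b \notin s -> fcoef x b = 0) ->
  x = \sum_(b <- s) fcoef x b *: delta b.
Proof.
move=> s_uniq xs; apply: fcoef_ext => c; rewrite fcoef_sum.
have [cs|cs] := boolP (c \in s).
  rewrite (bigD1_seq c) //= eqxx mulr1 big1_seq ?addr0 // => b /andP[bc _].
  by rewrite /= eq_sym (negPf bc) mulr0.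
rewrite xs // big1_seq // => b /andP[_ bs] /=.
by case: eqP => [cb|]; [rewrite cb bs in cs | rewrite mulr0].
Qed.

Section Lift.
Variables (M : lmodType A) (f : B -> M).

Definition free_lift x : M := \sum_(b <- supp x) fcoef x b *: f b.

(** Outside the common part of [s] and [supp x] all coefficients are 0. Hence the choice made by
    [supp] does not matter, and several vectors can be expanded over one list. *)
Lemma free_liftE x s : uniq s -> (forall b, b \notin s -> fcoef x b = 0) ->
  free_lift x = \sum_(b <- s) fcoef x b *: f b.
Proof.
move=> s_uniq xs; rewrite /free_lift.
rewrite (bigID [pred b | b \in s]) /= [X in _ + X]big1 ?addr0; last first.
  by move=> b /xs ->; rewrite scale0r.
rewrite [RHS](bigID [pred b | b \in supp x]) /= [X in _ = _ + X]big1 ?addr0.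
  rewrite -big_filter -[RHS]big_filter; apply: perm_big; apply: uniq_perm.
  - exact/filter_uniq/supp_uniq.
  - exact/filter_uniq.
  - by move=> b; rewrite !mem_filter andbC.
by move=> b /notin_supp ->; rewrite scale0r.
Qed.

Fact free_lift_linear : linear free_lift.
Proof.
move=> a x y; set s := undup (supp x ++ supp y).
have sP b : b \notin s -> fcoef x b = 0 /\ fcoef y b = 0.
  rewrite mem_undup mem_cat negb_or => /andP[bx by_].
  by split; apply: notin_supp.
rewrite !(free_liftE (s := s)) ?undup_uniq //.
- rewrite scaler_sumr -big_split; apply: eq_bigr => b _ /=.
  by rewrite scalerDl scalerA.
- by move=> b /sP[].
- by move=> b /sP[].
- by move=> b /sP[xb yb]; rewrite fcoefD fcoefZ xb yb mulr0 addr0.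
Qed.
HB.instance Definition _ :=
  GRing.isLinear.Build A free_module M *:%R free_lift free_lift_linear.

Lemma free_lift_delta b : free_lift (delta b) = f b.
Proof.
rewrite (free_liftE (s := [:: b])) ?big_seq1 /= ?eqxx ?scale1r // => c.
by rewrite inE => /negPf ->.
Qed.

End Lift.

Definition supported S x := forall b, ~ S b -> fcoef x b = 0.

Lemma supported_supp x : supported [eta mem (supp x)] x.
Proof. by move=> b /negP /notin_supp. Qed.

Lemma sub_supported S T x :
  (forall b, S b -> T b) -> supported S x -> supported T x.
Proof. by move=> ST Sx b Tb; apply: Sx => /ST. Qed.

Lemma supportedD S x y : supported S x -> supported S y -> supported S (x + y).
Proof. by move=> Sx Sy b Sb; rewrite fcoefD Sx ?Sy ?addr0. Qed.
Lemma supportedZ S a x : supported S x -> supported S (a *: x).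
Proof. by move=> Sx b Sb; rewrite fcoefZ Sx ?mulr0. Qed.
Lemma supported_delta S b : S b -> supported S (delta b).
Proof. by move=> Sb c Sc /=; case: eqP => // cb; rewrite cb in Sc. Qed.

Lemma free_ind (P : free_module -> Prop) S :
  P 0 -> (forall b, S b -> P (delta b)) ->
  (forall a x, P x -> P (a *: x)) -> (forall x y, P x -> P y -> P (x + y)) ->
  forall x, supported S x -> P x.
Proof.
move=> P0 Pd PZ PD x Sx.
rewrite (free_sum (supp_uniq x) (@notin_supp x)); elim: (supp x) => [|b s IHs].
  by rewrite big_nil.
rewrite big_cons; apply: PD => //; case: (pselect (S b)) => [/Pd|/Sx ->].
  exact: PZ.
by rewrite scale0r.
Qed.

Lemma eq_supported (M : lmodType A) (f g : {linear free_module -> M}) S :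
  (forall b, S b -> f (delta b) = g (delta b)) ->
  forall x, supported S x -> f x = g x.
Proof.
move=> fg; apply: free_ind => [|b /fg//|a x IH|x y IHx IHy].
- by rewrite !raddf0.
- by rewrite !linearZ IH.
- by rewrite !linearD; congr (_ + _).
Qed.

Lemma eq_free (M : lmodType A) (f g : {linear free_module -> M}) :
  (forall b, f (delta b) = g (delta b)) -> f =1 g.
Proof. by move=> fg x; apply: (@eq_supported M f g xpredT). Qed.

Lemma supported_map (f : {linear free_module -> free_module}) S T :
  (forall b, S b -> supported T (f (delta b))) ->
  forall x, supported S x -> supported T (f x).
Proof.
move=> fT; apply: free_ind => [|//|a x IH|x y IHx IHy].
- by rewrite raddf0.
- by rewrite linearZ; apply: supportedZ.
- by rewrite raddfD; apply: supportedD.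
Qed.

Definition image_supp (f : free_module -> free_module) s : seq B :=
  flatten [seq supp (f (delta b)) | b <- s].

Lemma supported_image_supp (f : {linear free_module -> free_module}) s x :
  supported [eta mem s] x -> supported [eta mem (image_supp f s)] (f x).
Proof.
apply: supported_map => b bs.
apply: (sub_supported _ (@supported_supp _)) => c /= cP.
by apply/flattenP; exists (supp (f (delta b))) => //; apply: map_f.
Qed.

Definition proj S : {linear free_module -> free_module} :=
  free_lift (fun b => if `[< S b >] then delta b else 0).

Lemma projE S x b : fcoef (proj S x) b = if `[< S b >] then fcoef x b else 0.
Proof.
apply: (@free_ind (fun x => fcoef (proj S x) b =
    if `[< S b >] then fcoef x b else 0) xpredT)
  => // [|c _|a {}x IHx|{}x y IHx IHy].
- by rewrite raddf0 fcoef0 if_same.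
- rewrite [proj S _]free_lift_delta; case: (asboolP (S c)) => Sc /=.
    by case: asboolP => // Sb; case: eqP => // bc; rewrite bc in Sb.
  by case: asboolP => // Sb; case: eqP => // bc; rewrite bc in Sb.
- by rewrite linearZ !fcoefZ IHx; case: asboolP => _; rewrite ?mulr0.
- by rewrite linearD !fcoefD IHx IHy; case: asboolP => _; rewrite ?addr0.
Qed.

Lemma supported_proj S x : supported S (proj S x).
Proof. by move=> b Sb; rewrite projE asboolF. Qed.

Lemma proj_id S x : supported S x -> proj S x = x.
Proof.
by move=> Sx; apply: fcoef_ext => b; rewrite projE; case: asboolP => // /Sx.
Qed.

End FreeModule.
Arguments delta {A B}.
Arguments proj {A B}.
Arguments free_lift {A B M}.
(** * Pure acyclic complexes of projective modules *)

Section Contraction.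
Variables (A : pzRingType) (B : choiceType).
Local Notation L := (free_module A B).
Local Notation End := {linear L -> L}.
Implicit Types (d p h H : End) (x y k : L) (b : B) (s t u : seq B).
Implicit Types (S T : B -> Prop).

(* The module [p L] with the differential [d].                                *)
Record diff_retract d p : Prop := DiffRetract {
  retr_dd : forall x, d (d x) = 0;
  retr_dp : forall x, d (p x) = d x;
  retr_pd : forall x, p (d x) = d x;
  retr_pp : forall x, p (p x) = p x
}.

(* [p L] is acyclic with flat cycles. *)
Definition pure_acyclic d p :=
  forall k, d k = 0 -> exists h, p k = d (h k).

Definition contracts d p H S :=
  forall x, supported S x -> d (H x) + H (d x) = p x.

(** Induction on the list: the error [p (k0 - d (h k0))] at a new cycle is again a cycle, so some
    [h0] bounds it. Adding [h0] composed with the error operator repairs [k0] and leaves the earlier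
    cycles alone, since their error is 0. *)
Lemma pure_acyclic_seq d p (ks : seq L) : diff_retract d p ->
  pure_acyclic d p -> (forall k, k \in ks -> d k = 0) ->
  exists h, forall k, k \in ks -> p k = d (h k).
Proof.
move=> [dd dp pd pp] pure; elim: ks => [|k0 ks IHks] ksP.
  by exists idfun.
have [|h hP] := IHks; first by move=> k kks; rewrite ksP // inE kks orbT.
have [|h0 h0P] := pure (p (k0 - d (h k0))).
  by rewrite dp linearB dd subr0 ksP ?inE ?eqxx.
exists (h \+ (h0 \o p \o (idfun \- (d \o h)))) => k.
rewrite inE /= linearD /= => /predU1P[->|kks].
  by rewrite -h0P pp linearB pd addrC subrK.
by rewrite [p (k - _)]linearB pd -hP // subrr !linear0 addr0.
Qed.

(* A single [h] serves the possibly infinitely generated module of all cycles *)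
(* in the span of [s]: if [d h1] fixes the boundaries of the basis elements   *)
(* [b] in [s], then a cycle with coefficients [k b] is also the combination   *)
(* of the finitely many cycles [b - h1 (d b)] with these coefficients.        *)
Lemma pure_acyclic_supported d p s : diff_retract d p -> pure_acyclic d p ->
  exists h, forall k, supported [eta mem s] k -> d k = 0 -> p k = d (h k).
Proof.
move=> dpP pure; have [dd dp pd pp] := dpP.
have [k /mapP[b _ ->]|h1 h1P] :=
  pure_acyclic_seq (ks := [seq d (delta b) | b <- s]) dpP pure.
  exact: dd.
pose z := idfun \- (h1 \o d) : End.
have zP b : b \in s -> d (z (delta b)) = 0.
  move=> bs; rewrite linearB /= -h1P ?pd ?subrr //.
  by apply/mapP; exists b.
have [k /mapP[b bs ->]|h2 h2P] :=
  pure_acyclic_seq (ks := [seq z (delta b) | b <- s]) dpP pure.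
  exact: zP.
exists h2 => k sk dk.
have zk : z k = k by rewrite /= dk linear0 subr0.
rewrite -zk -[LHS]/((p \o z) k) -[RHS]/((d \o h2 \o z) k).
apply: (eq_supported _ sk) => b bs; apply: h2P; exact/map_f.
Qed.

(** On the span of [s], [h1] solves [d x = d (h1 (d x))]. So the error [G] of [h1] as a contraction
    sends this span to cycles and vanishes on its boundaries; [h2] bounds the cycles [G x], and
    adding [h2 G] removes the error. *)
Lemma local_contraction d p s : diff_retract d p -> pure_acyclic d p ->
  exists H, (forall x, p (H x) = H x) /\ contracts d p H [eta mem s].
Proof.
move=> dpP pure; have [dd dp pd pp] := dpP.
have [h1 h1P] := pure_acyclic_supported (image_supp d s) dpP pure.
pose G := p \- (d \o h1) \- (p \o h1 \o d) : End.
have GP x : G x = p x - d (h1 x) - p (h1 (d x)) by [].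
have [h2 h2P] := pure_acyclic_supported (image_supp G s) dpP pure.
exists ((p \o h1) \+ (p \o h2 \o G)); split => [x|x sx].
  by rewrite /= linearD !pp.
have dx : d x = d (h1 (d x)).
  by rewrite -h1P ?pd //; apply: supported_image_supp.
have Gdx : G (d x) = 0.
  by rewrite GP pd -dx subrr dd !linear0 addr0.
have Gx : p (G x) = d (h2 (G x)).
  apply: h2P; first exact: supported_image_supp.
  by rewrite GP !linearB /= !dp -dx dd subr0 subrr.
rewrite -[X in d X]/(p (h1 x) + p (h2 (G x))).
rewrite -[X in _ + X]/(p (h1 (d x)) + p (h2 (G (d x)))).
rewrite Gdx !linear0 addr0 linearD !dp -Gx GP !linearB !pp pd.
by rewrite addrA subrK addrC subrK.
Qed.

(* Two local contractions differ by a chain map of degree -1, which is null   *)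
(* homotopic because the target is locally contractible.                      *)
Lemma extend_contraction d p H u t t' : diff_retract d p -> pure_acyclic d p ->
  {subset u <= t} ->
  (forall b, b \in u -> supported [eta mem t] (d (delta b))) ->
  (forall x, p (H x) = H x) -> contracts d p H [eta mem t] ->
  exists H', [/\ forall x, p (H' x) = H' x, contracts d p H' [eta mem t'] &
    forall x, supported [eta mem u] x -> H' x = H x].
Proof.
move=> dpP pure ut dut pH Ht; have [dd dp pd pp] := dpP.
have [G1 [pG1 G1P]] := local_contraction (t ++ t') dpP pure.
pose phi := H \- G1 : End.
have [G2 [pG2 G2P]] := local_contraction (image_supp phi t) dpP pure.
pose psi := G2 \o phi \o proj [eta mem t] : End.
(* The added term does not affect [d H' + H' d], because [d d = 0]. On the span of [u] it equals
   [phi = H - G1], because [phi] anticommutes with [d] there and [G2] contracts its values. *)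
pose H' := G1 \+ ((d \o psi) \- (psi \o d)) : End.
have H'E y : H' y = G1 y + (d (psi y) - psi (d y)) by [].
exists H'; split => [x|x t'x|x ux].
- by rewrite H'E linearD linearB pG1 pd /= pG2.
- rewrite -(G1P x); last first.
    by apply: sub_supported t'x => b; rewrite /= mem_cat => ->; rewrite orbT.
  rewrite !H'E linearD linearB !dd !linear0 addr0 add0r.
  by rewrite addrACA addNr addr0.
have tx : supported [eta mem t] x by apply: sub_supported ux.
have tdx : supported [eta mem t] (d x) by apply: supported_map ux.
have -> : H x = G1 x + phi x by rewrite addrC subrK.
have psiE y : supported [eta mem t] y -> psi y = G2 (phi y).
  by move=> ty; rewrite /psi /= proj_id.
rewrite H'E !psiE //; congr (_ + _).
have phid : phi (d x) = - d (phi x).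
  apply/eqP; rewrite -addr_eq0 addrC; apply/eqP.
  rewrite /= linearB addrACA -opprD Ht // G1P ?subrr //.
  by apply: sub_supported tx => b; rewrite /= mem_cat => ->.
have pphi : p (phi x) = phi x by rewrite /= linearB pH pG1.
rewrite phid linearN opprK -[in RHS]pphi -G2P //.
exact: supported_image_supp.
Qed.

Lemma glue_linear (J : Type) (S : J -> B -> Prop) (f : J -> End) :
  (forall i j b, S i b -> S j b -> f i (delta b) = f j (delta b)) ->
  exists g : End, forall i x, supported (S i) x -> g x = f i x.
Proof.
move=> fS.
have /choice[F FP] b : exists y, forall i, S i b -> y = f i (delta b).
  have [[i Sib]|nS] := pselect (exists i, S i b).
    by exists (f i (delta b)) => j; apply: fS.
  by exists 0 => i Sib; case: nS; exists i.
exists (free_lift F) => i; apply: eq_supported => b Sib.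
by rewrite [LHS]free_lift_delta (FP b i).
Qed.

Lemma supported_directed (J : Type) (j0 : J) (S : J -> B -> Prop) x :
  (forall i j, exists l, forall b, S i b \/ S j b -> S l b) ->
  supported (fun b => exists j, S j b) x -> exists j, supported (S j) x.
Proof.
move=> dirS; move: x.
apply: free_ind => [|b [j Sjb]|a x [j Sj]|x y [i Si] [j Sj]].
- by exists j0.
- by exists j; apply: supported_delta.
- by exists j; apply: supportedZ.
have [l Sl] := dirS i j; exists l; apply: supportedD.
  by apply: sub_supported Si => b ?; apply: Sl; left.
by apply: sub_supported Sj => b ?; apply: Sl; right.
Qed.

Record stable_contraction d p S H : Prop := StableContraction {
  stab_d : forall x, supported S x -> supported S (d x);
  stab_p : forall x, supported S x -> supported S (p x);
  stab_H : forall x, supported S x -> supported S (H x);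
  stab_contracts : contracts d p H S
}.

(** * Countably generated contracted subcomplexes *)

Section Countable.
Variables (d p : End).
Hypotheses (dpP : diff_retract d p) (pure : pure_acyclic d p).

(* One step of the construction of an increasing sequence of finite sets of   *)
(* basis elements; later stages keep [homotopy] unchanged on [inner].         *)
Record stage := Stage {
  inner : seq B;
  outer : seq B;
  homotopy : End;
  inner_outer : {subset inner <= outer};
  inner_d : forall b, b \in inner -> supported [eta mem outer] (d (delta b));
  inner_p : forall b, b \in inner -> supported [eta mem outer] (p (delta b));
  homotopy_p : forall x, p (homotopy x) = homotopy x;
  homotopy_contracts : contracts d p homotopy [eta mem outer]
}.

(** The outer set becomes the inner one, and the new outer set adds the supports of its images under
    [d], [p] and the current homotopy; [extend_contraction] provides the new homotopy. *)
Lemma next_stage_ex (z : stage) : exists z' : stage, [/\ inner z' = outer z,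
  forall x, supported [eta mem (inner z)] x -> homotopy z' x = homotopy z x &
  forall b, b \in outer z ->
    supported [eta mem (outer z')] (homotopy z (delta b))].
Proof.
case: z => u t H ut dut put pH Ht /=.
pose t' := t ++ image_supp d t ++ image_supp p t ++ image_supp H t.
have [H' [pH' Ht' H'H]] := extend_contraction t' dpP pure ut dut pH Ht.
have tt' (f : End) : {subset image_supp f t <= t'} ->
    forall b, b \in t -> supported [eta mem t'] (f (delta b)).
  move=> ft b bt; apply: sub_supported ft _.
  exact/supported_image_supp/supported_delta.
have sub_t : {subset t <= t'} by move=> b bt; rewrite mem_cat bt.
have sub_d : {subset image_supp d t <= t'}.
  by move=> b bt; rewrite !mem_cat bt orbT.
have sub_p : {subset image_supp p t <= t'}.
  by move=> b bt; rewrite !mem_cat bt !orbT.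
have sub_H : {subset image_supp H t <= t'}.
  by move=> b bt; rewrite !mem_cat bt !orbT.
exists (Stage sub_t (tt' d sub_d) (tt' p sub_p) pH' Ht'); split=> //.
exact: tt'.
Qed.

Lemma stable_contraction_countable b0 :
  exists T H, T b0 /\ stable_contraction d p T H.
Proof.
have /choice[next nextP] := next_stage_ex.
have [H0 [pH0 H0P]] := local_contraction [:: b0] dpP pure.
(* With an empty inner set the closure conditions are vacuous; [b0] becomes inner at stage 1. *)
have z0 : exists z : stage, outer z = [:: b0].
  have sub0 : {subset [::] <= [:: b0]} by [].
  have supp0 (f : End) b :
    b \in [::] -> supported [eta mem [:: b0]] (f (delta b)) by [].
  by exists (Stage sub0 (supp0 d) (supp0 p) pH0 H0P).
case: z0 => z0 z0E; pose z n := iter n next z0.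
have innerS n : inner (z n.+1) = outer (z n) by case: (nextP (z n)).
have inner_sub n : {subset inner (z n) <= inner (z n.+1)}.
  by rewrite innerS; apply: inner_outer.
have inner_le m n : (m <= n)%N -> {subset inner (z m) <= inner (z n)}.
  move=> /subnK <-; elim: (n - m)%N => // k IHk b /IHk; exact: inner_sub.
have homE m n x : (m <= n)%N -> supported [eta mem (inner (z m))] x ->
    homotopy (z n) x = homotopy (z m) x.
  move=> /subnK <- mx; elim: (n - m)%N => // k IHk; rewrite -IHk addSn.
  case: (nextP (z (k + m)%N)) => _ + _; apply.
  by apply: sub_supported mx; apply/inner_le/leq_addl.
pose S n b := b \in inner (z n).
have [|H HP] := @glue_linear nat S (fun n => homotopy (z n)).
  move=> i j b ib jb; case: (leqP i j) => ij.
    by rewrite (homE i j) //; apply: supported_delta.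
  by rewrite (homE j i) //; [apply: ltnW | apply: supported_delta].
have dir x :
    supported (fun b => exists n, S n b) x -> exists n, supported (S n) x.
  apply: (supported_directed 0%N) => i j.
  exists (maxn i j) => b [] /inner_le; apply.
    exact: leq_maxl.
  exact: leq_maxr.
have inT n x : supported [eta mem (outer (z n))] x ->
    supported (fun b => exists n, S n b) x.
  by apply: sub_supported => b bn; exists n.+1; rewrite /S innerS.
exists (fun b => exists n, S n b), H; split.
  by exists 1%N; rewrite /S innerS z0E inE.
split=> [x /dir[n nx]|x /dir[n nx]|x /dir[n nx]|x /dir[n nx]].
- exact/(inT n)/(supported_map (@inner_d (z n)) nx).
- exact/(inT n)/(supported_map (@inner_p (z n)) nx).
- rewrite (HP n) //; apply: (inT n.+1); case: (nextP (z n)) => _ _ hz.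
  apply: (supported_map _ nx) => b bn; apply/hz/inner_outer/bn.
(* The boundary [d x] is only known to lie in the inner set of stage [n.+1], so both values of [H]
   are read off there. *)
- have nx' : supported (S n.+1) x by apply: sub_supported nx; apply: inner_sub.
  have dx : supported (S n.+1) (d x).
    by rewrite /S innerS; apply: (supported_map (@inner_d (z n)) nx).
  rewrite !(HP n.+1) // homotopy_contracts //.
  by apply: sub_supported nx'; apply: inner_outer.
Qed.

End Countable.

(** * Quotients by contracted subcomplexes *)

Section Quotient.
Variables (d p H : End) (S : B -> Prop).
Hypotheses (dpP : diff_retract d p) (SH : stable_contraction d p S H).

(** The quotient by the span of [S] is realised inside [L], on the complementary basis elements, so
    it is again given by two endomorphisms [Q \o d] and [Q \o p] of [L]. *)
Definition quot S : End := proj (fun b => ~ S b).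

Lemma quotE x : quot S x = x - proj S x.
Proof.
apply: fcoef_ext => b; rewrite fcoefD fcoefN !projE asbool_neg.
by case: asboolP => _ /=; rewrite ?subrr ?subr0.
Qed.

Lemma quot0 x : supported S x -> quot S x = 0.
Proof. by move=> Sx; rewrite quotE proj_id ?subrr. Qed.

Lemma quot_eq0 x : quot S x = 0 -> supported S x.
Proof. by rewrite quotE => /subr0_eq ->; apply: supported_proj. Qed.

Lemma quotK x : proj S x + quot S x = x.
Proof. by rewrite quotE addrC subrK. Qed.

Lemma quot_stable (f : End) x :
  (forall y, supported S y -> supported S (f y)) ->
  quot S (f (quot S x)) = quot S (f x).
Proof.
move=> fS; rewrite -[in RHS](quotK x) !linearD [X in X + _]quot0 ?add0r //.
by apply: fS; apply: supported_proj.
Qed.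

Let Q := quot S.

Lemma quot_dq x : Q (d (Q x)) = Q (d x).
Proof. exact/quot_stable/(stab_d SH). Qed.
Lemma quot_pq x : Q (p (Q x)) = Q (p x).
Proof. exact/quot_stable/(stab_p SH). Qed.

Lemma diff_retract_quot : diff_retract (Q \o d) (Q \o p).
Proof.
have [dd dp pd pp] := dpP; split=> x /=.
- by rewrite quot_dq dd linear0.
- by rewrite quot_dq dp.
- by rewrite quot_pq pd.
- by rewrite quot_pq pp.
Qed.

(** If [k] is a cycle of the quotient, then [d k] lies in the span of [S], so [d (H (d k)) = d k].
    Thus [k - H (d k)] is a genuine cycle with the same class, and purity of [L] applies to it. *)
Lemma pure_acyclic_quot : pure_acyclic d p -> pure_acyclic (Q \o d) (Q \o p).
Proof.
have [dd dp pd pp] := dpP; move=> pure k /= /quot_eq0 Sdk.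
have dHd : d (H (d k)) = d k.
  by have := stab_contracts SH Sdk; rewrite dd linear0 addr0 pd.
have [|h hP] := pure (k - H (d k)); first by rewrite linearB dHd subrr.
exists (h \o (idfun \- (H \o d))); rewrite /= -hP !linearB.
rewrite [X in _ - X](_ : _ = 0) ?subr0 //.
by apply/quot0/(stab_p SH)/(stab_H SH).
Qed.

(** The map [g] extends [H] to all of [L], with an error [psi] that commutes with [d] and kills the
    span of [S]. So [psi] is defined on the quotient, and composing it with [K] there contracts it
    on the span of [S] and [T]. *)
Lemma extend_stable_contraction T K :
  (forall x, supported S x -> H (p x) = H x) ->
  stable_contraction (Q \o d) (Q \o p) T K ->
  exists H', [/\ stable_contraction d p (fun b => S b \/ T b) H',
    forall x, H' (p x) = H' x & forall x, supported S x -> H' x = H x].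
Proof.
move=> Hp TK; have [dd dp pd pp] := dpP.
have [g gE] : exists g : End, forall x, g x = H (proj S (p x)).
  by exists (H \o proj S \o p).
have [psi psiE] : exists psi : End, forall x, psi x = p x - d (g x) - g (d x).
  by exists (p \- (d \o g) \- (g \o d)).
have [H' H'E] : exists H' : End, forall x, H' x = g x + psi (K (Q (p x))).
  by exists (g \+ (psi \o K \o Q \o p)).
have gS x : supported S x -> g x = H x.
  by move=> Sx; rewrite gE proj_id ?Hp //; apply: (stab_p SH).
have g_supp x : supported S (g x).
  by rewrite gE; apply/(stab_H SH)/supported_proj.
have gp x : g (p x) = g x by rewrite !gE pp.
have psi0 x : supported S x -> psi x = 0.
  move=> Sx; rewrite psiE !gS //; last exact: (stab_d SH).
  by rewrite -(stab_contracts SH Sx) addrAC addrK subrr.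
have psiQ x : psi (Q x) = psi x.
  rewrite -[in RHS](quotK x) linearD [X in X + _]psi0 ?add0r //.
  exact: supported_proj.
have dpsi x : d (psi x) = psi (d x).
  by rewrite !psiE !linearB dp pd !dd !linear0 !addr0.
have suppQ x : supported (fun b => S b \/ T b) x <-> supported T (Q x).
  split=> [STx b nTb|TQx b /not_orP[nSb nTb]].
    rewrite quotE fcoefD fcoefN projE.
    case: asboolP => Sb; first by rewrite subrr.
    by rewrite STx ?subr0 // => -[].
  by rewrite -(quotK x) fcoefD TQx // supported_proj // addr0.
exists H'; split=> [|x|x Sx].
- split=> x; rewrite ?suppQ => TQx.
  + by rewrite -quot_dq; apply: (stab_d TK).
  + by rewrite -quot_pq; apply: (stab_p TK).
  + rewrite H'E linearD quot0 // add0r psiE !linearB.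
    rewrite [Q (d _)]quot0 ?subr0; last exact: (stab_d SH).
    rewrite [Q (g _)]quot0 // subr0; apply/(stab_p TK)/(stab_H TK).
    by rewrite -quot_pq; apply: (stab_p TK).
  + have Tpx : supported T (Q (p x)) by rewrite -quot_pq; apply: (stab_p TK).
    rewrite !H'E linearD dpsi -psiQ addrACA -linearD pd.
    have := stab_contracts TK Tpx; rewrite /= quot_dq dp quot_pq pp => ->.
    by rewrite psiQ psiE gp dp pp [X in X + _]addrC addrC addrA !subrK.
- by rewrite !H'E gp pp.
- by rewrite H'E gS // quot0 ?linear0 ?addr0 //; apply: (stab_p SH).
Qed.

End Quotient.

(** * Contraction by Zorn's lemma *)

Record partial_contraction d p := PartialContraction {
  part_supp : B -> Prop;
  part_map : End;
  part_stable : stable_contraction d p part_supp part_map;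
  part_p : forall x, supported part_supp x -> part_map (p x) = part_map x
}.

Theorem pure_acyclic_contractible d p :
  diff_retract d p -> pure_acyclic d p ->
  exists H, forall x, d (H x) + H (d x) = p x.
Proof.
move=> dpP pure; have [dd dp pd pp] := dpP.
(* Only a preorder: maps that agree on a common support may differ elsewhere. *)
pose R (z w : partial_contraction d p) := `[<
  (forall b, part_supp z b -> part_supp w b) /\
  forall x, supported (part_supp z) x -> part_map w x = part_map z x >].
have supp0 x : supported (fun=> False) x -> x = 0.
  by move=> x0; apply: fcoef_ext => b; apply: x0.
have st0 : stable_contraction d p (fun=> False) \0.
  by split=> x /supp0 ->; rewrite !linear0 ?addr0.
have p0 : forall x, supported (fun=> False) x -> \0 (p x) = \0 x :> L by [].
have [|||z zmax] := @ZL_preorder _ (PartialContraction st0 p0) R.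
- by move=> z; apply/asboolP.
- move=> w z v /asboolP[zw wz] /asboolP[wv vw]; apply/asboolP.
  split=> [b /zw/wv//|x zx].
  by rewrite vw ?wz //; apply: sub_supported zx.
- move=> C Ctot.
  have [[z0 Cz0]|C0] := pselect (exists z, C z); last first.
    by exists (PartialContraction st0 p0) => z Cz; case: C0; exists z.
  pose S (j : {z | C z}) := part_supp (sval j).
  have le (j l : {z | C z}) : R (sval j) (sval l) \/ R (sval l) (sval j).
    exact: Ctot _ _ (proj2_sig j) (proj2_sig l).
  have [|H HP] := @glue_linear _ S (fun j => part_map (sval j)).
    move=> j l b jb lb; case: (le j l) => /asboolP[_ jl].
      by rewrite jl //; apply: supported_delta.
    by rewrite jl //; apply: supported_delta.
  have dir x :
      supported (fun b => exists j, S j b) x -> exists j, supported (S j) x.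
    apply: (supported_directed (exist _ z0 Cz0)) => j l.
    by case: (le j l) => /asboolP[jl _]; [exists l | exists j] => b [] // /jl.
  have inS j x : supported (S j) x -> supported (fun b => exists j, S j b) x.
    by apply: sub_supported => b; exists j.
  have stH : stable_contraction d p (fun b => exists j, S j b) H.
    split=> x /dir[j jx].
    + exact/(inS j)/(stab_d (part_stable (sval j))).
    + exact/(inS j)/(stab_p (part_stable (sval j))).
    + by rewrite (HP j) //; apply/(inS j)/(stab_H (part_stable (sval j))).
    + rewrite !(HP j) //; last exact: (stab_d (part_stable (sval j))).
      exact: (stab_contracts (part_stable (sval j))).
  have Hp x : supported (fun b => exists j, S j b) x -> H (p x) = H x.
    move=> /dir[j jx]; rewrite !(HP j) //; first exact: part_p.
    exact: (stab_p (part_stable (sval j))).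
  exists (PartialContraction stH Hp) => z Cz; apply/asboolP.
  split=> [b zb|x zx] /=.
    by exists (exist _ z Cz).
  exact: (HP (exist _ z Cz)).
case: z zmax => S H SH Hp zmax.
have [all_S|] := pselect (forall b, S b).
  by exists H => x; apply: (stab_contracts SH) => b; case.
move=> /existsNP[b0 nSb0].
(* A missing [b0] lies in a contracted subcomplex of the quotient, and lifting that contraction
   contradicts maximality. *)
have [T [K [Tb0 TK]]] := stable_contraction_countable
  (diff_retract_quot dpP SH) (pure_acyclic_quot dpP SH pure) b0.
have [H' [stH' H'p H'H]] := extend_stable_contraction dpP SH Hp TK.
have /zmax/asboolP[sub _] :
    R (PartialContraction SH Hp) (PartialContraction stH' (fun x _ => H'p x)).
  by apply/asboolP; split=> //= b; left.
by case: nSb0; apply: sub => /=; right.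
Qed.
End Contraction.

(** * Noetherian induction on the annihilator *)

(** Otherwise counterexamples can be chosen in a strictly ascending sequence. The finitely many
    generators of their union all lie in one member [I m], which then equals [I m.+1]. *)
Lemma noetherian_ind (R : comPzRingType) (P : (R -> Prop) -> Prop) :
  noetherian R ->
  (forall I, is_ideal I -> (forall J, is_ideal J -> (forall r, I r -> J r) ->
     (exists r, J r /\ ~ I r) -> P J) -> P I) ->
  forall I, is_ideal I -> P I.
Proof.
move=> Rnoeth Pstep I0 I0_ideal; apply: contrapT => nPI0.
pose T := {I : R -> Prop | is_ideal I /\ ~ P I}.
have /choice[next nextP] (I : T) : exists J : T,
    (forall r, sval I r -> sval J r) /\ exists r, sval J r /\ ~ sval I r.
  case: I => I [I_ideal nPI] /=; apply: contrapT => nJ; apply: nPI.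
  apply: Pstep => // J J_ideal IJ JI; apply: contrapT => nPJ.
  by apply: nJ; exists (exist _ J (conj J_ideal nPJ)).
pose J n := iter n next (exist _ I0 (conj I0_ideal nPI0)).
pose I n : R -> Prop := sval (J n).
have I_ideal n : is_ideal (I n) by case: (proj2_sig (J n)).
have I_le m n r : (m <= n)%N -> I m r -> I n r.
  move=> /subnK <- Imr; elim: (n - m)%N => // k IHk; rewrite addSn.
  by apply: (proj1 (nextP _)).
have U_ideal : is_ideal (fun r => exists n, I n r).
  split=> [|x y [m Ix] [n Iy]|a x [n Ix]].
  - by exists 0%N; case: (I_ideal 0%N).
  - exists (maxn m n); case: (I_ideal (maxn m n)) => _ ID _.
    apply: ID; first by apply: I_le Ix; apply: leq_maxl.
    by apply: I_le Iy; apply: leq_maxr.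
  - by exists n; case: (I_ideal n) => _ _; apply.
have [n [e eP]] := Rnoeth _ U_ideal.
have /choice[k kP] i : exists k, I k (e i).
  apply/eP; exists (fun j => (j == i)%:R).
  rewrite (bigD1 i) //= eqxx mul1r big1 ?addr0 // => j /negPf ->.
  by rewrite mul0r.
pose m := (\max_i k i)%N.
have [r [Ir nIr]] := proj2 (nextP (J m)).
have /eP[c rE] : exists n, I n r by exists m.+1.
have [Im0 ImD ImM] := I_ideal m; apply: nIr; rewrite rE.
apply: (big_ind (I m)) => // i _; apply: ImM; apply: I_le (kP i).
exact: leq_bigmax.
Qed.

(** * Right ideals and coordinates *)

Section RightIdeals.
Variables (A : pzRingType) (B : choiceType).
Local Notation L := (free_module A B).
Local Notation End := {linear L -> L}.
Implicit Types (U V : A -> Prop) (x y : L).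

Definition right_ideal U :=
  [/\ U 0, forall a b, U a -> U b -> U (a + b) & forall a b, U a -> U (a * b)].

Lemma right_ideal_sum U (I : Type) (r : seq I) (F : I -> A) :
  right_ideal U -> (forall i, U (F i)) -> U (\sum_(i <- r) F i).
Proof. by move=> [U0 UD _] UF; apply: big_ind. Qed.

Lemma right_idealN U a : right_ideal U -> U a -> U (- a).
Proof. by move=> [_ _ UM] /(UM _ (-1)); rewrite mulrN1. Qed.

(* The submodule [U L] of [L]. *)
Definition valued U x := forall b, U (fcoef x b).

Lemma valuedD U x y :
  right_ideal U -> valued U x -> valued U y -> valued U (x + y).
Proof. by move=> [_ UD _] Ux Uy b; apply: UD. Qed.

Lemma valuedN U x : right_ideal U -> valued U x -> valued U (- x).
Proof. by move=> rU Ux b; apply: right_idealN. Qed.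

Lemma valuedB U x y :
  right_ideal U -> valued U x -> valued U y -> valued U (x - y).
Proof. by move=> rU Ux Uy; apply: valuedD => //; apply: valuedN. Qed.

Lemma valued_sub U V x : (forall a, V a -> U a) -> valued V x -> valued U x.
Proof. by move=> VU Vx b; apply: VU. Qed.

(** A left linear map multiplies coordinates on the right by its matrix entries; this is why right
    ideals appear. *)
Lemma valued_map U (f : End) x : right_ideal U -> valued U x -> valued U (f x).
Proof.
move=> rU Ux b; rewrite (free_sum (supp_uniq x) (@notin_supp _ _ x)) linear_sum.
rewrite fcoef_sum; apply: right_ideal_sum => // c; rewrite linearZ fcoefZ.
by case: rU => _ _; apply; apply: Ux.
Qed.

End RightIdeals.

(** * Homology with coefficients in quotients of right ideals *)

Section NoetherianInduction.
Variables (R : comPzRingType) (A : algebra R) (B : choiceType).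
Local Notation L := (free_module A B).
Local Notation End := {linear L -> L}.
Local Notation ralg := (alg_str A).
Variables (d p : End).
Implicit Types (U V W : A -> Prop) (x y : L) (q : spec R).

Definition central_scale (r : R) x : L := ralg r *: x.
Fact central_scale_linear r : linear (central_scale r).
Proof.
by move=> a x y; rewrite /central_scale scalerDr !scalerA alg_central.
Qed.
HB.instance Definition _ r :=
  GRing.isLinear.Build A L L *:%R (central_scale r) (central_scale_linear r).

(** The extended ideal [q A]. *)
Definition in_extension q (a : A) :=
  exists (n : nat) (r : 'I_n -> R) (e : 'I_n -> A),
  (forall i, r i \in spec_pred q) /\ a = \sum_i ralg (r i) * e i.

(* After inverting one element outside [q], the fibre at [q] is contractible  *)
(* on any finite set of basis elements.                                       *)
Definition fibre_contractible q := forall s : seq B, exists (h : End) (r : R),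
  r \notin spec_pred q /\ forall b c, b \in s ->
    in_extension q
      (fcoef (ralg r *: p (delta b) - d (h (delta b)) - h (d (delta b))) c).

(** For [V] inside [U] this is acyclicity of the right module [U / V] tensored over [A] with [p L],
    where [U / V] tensored with [L] is read as [U L / V L]. *)
Definition acyclic_quotient U V := forall x, valued U x -> valued V (d x) ->
  exists y, valued U y /\ valued V (p x - d y).

Definition scaled r U (a : A) := exists u, U u /\ a = ralg r * u.
Definition sum_ideal U V (a : A) := exists u v, [/\ U u, V v & a = u + v].
Definition colon V r (a : A) := V (ralg r * a).
(** The annihilator in [R] of [U / V], on which the induction runs. *)
Definition conductor U V (r : R) := forall u, U u -> V (ralg r * u).

Lemma right_ideal_scaled r U : right_ideal U -> right_ideal (scaled r U).
Proof.
move=> [U0 UD UM]; split=> [|_ _ [u [Uu ->]] [v [Uv ->]]|_ b [u [Uu ->]]].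
- by exists 0; rewrite mulr0.
- by exists (u + v); rewrite mulrDr; split => //; apply: UD.
- by exists (u * b); rewrite mulrA; split => //; apply: UM.
Qed.

Lemma right_ideal_sum_ideal U V :
  right_ideal U -> right_ideal V -> right_ideal (sum_ideal U V).
Proof.
move=> [U0 UD UM] [V0 VD VM].
split=> [|_ _ [u [v [Uu Vv ->]]] [u' [v' [Uu' Vv' ->]]]|_ b [u [v [Uu Vv ->]]]].
- by exists 0, 0; rewrite addr0.
- by exists (u + u'), (v + v'); split; [apply: UD|apply: VD|rewrite addrACA].
- by exists (u * b), (v * b); split; [apply: UM|apply: VM|rewrite mulrDl].
Qed.

Lemma right_ideal_colon V r : right_ideal V -> right_ideal (colon V r).
Proof.
move=> [V0 VD VM]; split=> [|a b Va Vb|a b Va]; rewrite /colon.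
- by rewrite mulr0.
- by rewrite mulrDr; apply: VD.
- by rewrite mulrA; apply: VM.
Qed.

Lemma right_ideal_cap U V : right_ideal U -> right_ideal V ->
  right_ideal (fun a => U a /\ V a).
Proof.
move=> [U0 UD UM] [V0 VD VM]; split=> // [a b [Ua Va] [Ub Vb]|a b [Ua Va]].
  by split; [apply: UD | apply: VD].
by split; [apply: UM | apply: VM].
Qed.

Lemma conductor_ideal U V :
  (forall u, V u -> U u) -> right_ideal V -> is_ideal (conductor U V).
Proof.
move=> VU [V0 VD VM]; split=> [u _|r s Ir Is u Uu|r s Is u Uu].
- by rewrite rmorph0 mul0r.
- by rewrite rmorphD mulrDl; apply: VD; [apply: Ir | apply: Is].
- rewrite rmorphM -mulrA alg_central; apply: VM; exact: Is.
Qed.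

(** Coordinates are split one by one; the choice of 0 outside [supp x] keeps both parts finitely
    supported. *)
Lemma valued_sum_ideal U V x : valued (sum_ideal U V) x ->
  right_ideal U -> right_ideal V ->
  exists u v, [/\ valued U u, valued V v & x = u + v].
Proof.
move=> UVx [U0 UD UM] [V0 VD VM].
have /choice[f fP] b :
    exists u, [/\ U u, V (fcoef x b - u) & b \notin supp x -> u = 0].
  have [bx|bx] := boolP (b \in supp x).
    by have [u [v [Uu Vv ->]]] := UVx b; exists u; rewrite [u + v]addrC addrK.
  by exists 0; rewrite subr0 notin_supp.
have ffin : exists s : seq B, forall b, b \notin s -> f b = 0.
  by exists (supp x) => b /(let: And3 _ _ h := fP b in h).
pose u : L := Free ffin.
exists u, (x - u); split=> [b|b|]; last by rewrite addrC subrK.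
  by case: (fP b).
by case: (fP b).
Qed.

Hypotheses (dpP : diff_retract d p) (Rnoeth : noetherian R).
Hypothesis fibres : forall q, fibre_contractible q.

(** The middle term of the long exact sequence for [V / W], [U / W], [U / V]: the error of a
    solution modulo [V] is a cycle modulo [W] with coordinates in [V], and is solved there. *)
Lemma acyclic_quotient_trans U V W :
  (forall a, V a -> U a) -> (forall a, W a -> V a) ->
  right_ideal U -> right_ideal V -> right_ideal W ->
  acyclic_quotient U V -> acyclic_quotient V W -> acyclic_quotient U W.
Proof.
move=> VU WV rU rV rW UV VW x Ux Wdx; have [dd dp pd pp] := dpP.
have [|y [Uy Vy]] := UV x Ux; first exact: valued_sub Wdx.
have [|z [Vz Wz]] := VW _ Vy; first by rewrite linearB dp dd subr0.
exists (y + z); split; first by apply: valuedD => //; apply: valued_sub Vz.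
by move: Wz; rewrite linearB pp pd linearD opprD addrA.
Qed.

Lemma acyclic_quotientT U V : right_ideal U -> right_ideal V ->
  (forall a, U a -> V a) -> acyclic_quotient U V.
Proof.
move=> [U0 _ _] rV UV x Ux _; exists 0; split=> [b|]; first exact: U0.
by rewrite linear0 subr0; apply: valued_map => //; apply: valued_sub Ux.
Qed.

Lemma in_extension_mul q U V u a : right_ideal V -> U u -> in_extension q a ->
  (forall r, r \in spec_pred q -> conductor U V r) -> V (u * a).
Proof.
move=> rV Uu [n [r [e [rq ->]]]] UV; rewrite mulr_sumr.
apply: right_ideal_sum => // i.
rewrite mulrA -alg_central; case: rV => _ _; apply; exact: UV.
Qed.

Lemma acyclic_quotient_all U V : right_ideal U -> right_ideal V ->
  (forall a, V a -> U a) -> acyclic_quotient U V.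
Proof.
have [dd dp pd pp] := dpP.
move=> rU rV VU.
move: {-2}(conductor U V) (erefl (conductor U V)) (conductor_ideal VU rV).
move=> I + I_ideal; move: I I_ideal U V rU rV VU.
apply: noetherian_ind => // I I_ideal IH U V rU rV VU IE.
have IHc U' V' r :
    right_ideal U' -> right_ideal V' -> (forall a, V' a -> U' a) ->
    (forall s, conductor U V s -> conductor U' V' s) -> conductor U' V' r ->
    ~ conductor U V r -> acyclic_quotient U' V'.
  move=> rU' rV' VU' sub Jr nIr; apply: (IH (conductor U' V')) => //.
  - exact: conductor_ideal.
  - by rewrite IE.
  - by exists r; rewrite IE.
(* [M r / V] and [U / M r] are the image and the cokernel of [r] on [U / V]. *)
pose M r := sum_ideal V (scaled r U).
have rM r : right_ideal (M r).
  by apply: right_ideal_sum_ideal => //; apply: right_ideal_scaled.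
have VM r a : V a -> M r a.
  move=> Va; exists a, 0; rewrite addr0; split=> //.
  by case: (right_ideal_scaled r rU).
have MU r a : M r a -> U a.
  move=> [v [_ [Vv [u [Uu ->]] ->]]]; case: rU => _ UD UM.
  apply: UD; first exact: VU.
  by rewrite alg_central; apply: UM.
have UM_acyclic r : ~ conductor U V r -> acyclic_quotient U (M r).
  move=> nIr; apply: (IHc _ _ r) => // [a /MU//|s Is u Uu|u Uu].
    exact/VM/Is.
  exists 0, (ralg r * u); rewrite add0r; split=> //; first by case: rV.
  by exists u.
have [I1|nI1] := pselect (conductor U V 1).
  apply: acyclic_quotientT => // a Ua.
  by rewrite -[a]mul1r -(rmorph1 ralg); apply: I1.
have [[r [s [nIr nIs Irs]]]|I_prime] := pselect (exists r s,
    [/\ ~ conductor U V r, ~ conductor U V s & conductor U V (r * s)]).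
  (* Here [r] kills [U / M r] and [s] kills [M r / V], so both annihilators are strictly larger. *)
  apply: (acyclic_quotient_trans _ _ rU (rM r) rV (UM_acyclic r nIr)).
  - exact: MU.
  - exact: VM.
  apply: (IHc _ _ s) => // [a /VM//|t It a /MU|_ [v [_ [Vv [u [Uu ->]] ->]]]].
    exact: It.
  case: rV => _ VD VMul; rewrite mulrDr; apply: VD.
    by rewrite alg_central; apply: VMul.
  by rewrite mulrA -rmorphM mulrC; apply: Irs.
have [I0 ID IM] := conductor_ideal VU rV.
have [q qE] :
    exists q : spec R, forall r, r \in spec_pred q <-> conductor U V r.
  pose P : {pred R} := fun r => `[< conductor U V r >].
  have PE r : r \in P <-> conductor U V r by split=> /asboolP.
  have P0 : 0 \in P by apply/PE.
  have PD (x y : R) : x \in P -> y \in P -> x + y \in P.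
    by move=> /PE Px /PE Py; apply/PE/ID.
  have PM (a x : R) : x \in P -> a * x \in P by move=> /PE Px; apply/PE/IM.
  have P1 : 1 \notin P by apply/negP => /PE/nI1.
  have PP (x y : R) : x * y \in P -> (x \in P) || (y \in P).
    move=> /PE Pxy; apply: contrapT => /negP.
    rewrite negb_or => /andP[/negP nx /negP ny].
    by apply: I_prime; exists x, y; split => // /PE //.
  by exists (Spec P0 PD PM P1 PP).
move=> x Ux Vdx.
have [h [a [/negP aq hP]]] := fibres q (supp x).
have nIa : ~ conductor U V a by move=> /qE.
(* The homotopy error on [x] has coordinates in [U q A], which lies in [V] because [q] annihilates
   [U / V]; and [h (d x)] has coordinates in [V]. *)
have Vax : valued V (ralg a *: p x - d (h x)).
  pose f := (central_scale a \o p) \- (d \o h) \- (h \o d) : End.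
  have -> : ralg a *: p x - d (h x) = f x + h (d x) by rewrite /= subrK.
  apply: valuedD => //; last exact: valued_map.
  rewrite (free_sum (supp_uniq x) (@notin_supp _ _ x)) linear_sum => c.
  rewrite fcoef_sum big_seq; apply: big_ind; try by case: rV.
  move=> b bx; rewrite linearZ fcoefZ.
  apply: in_extension_mul (Ux b) (hP b c bx) _ => //.
  by move=> r /qE.
have scale_M z : valued U z -> valued (M a) (ralg a *: z).
  move=> Uz b; rewrite fcoefZ; exists 0, (ralg a * fcoef z b).
  by rewrite add0r; split => //; [case: rV | exists (fcoef z b)].
have dhx : valued (M a) (d (h x)).
  rewrite -[d (h x)](subKr (ralg a *: p x)); apply: valuedB => //.
    by apply: scale_M; apply: valued_map.
  by apply: valued_sub Vax; apply: VM.
(* By induction the cokernel of [a] is acyclic, so [p (h x) = d y + v + a w]; applying [d] gives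
   [d (h x) = a (d w)] modulo [V]. *)
have [y [Uy /valued_sum_ideal[]//]] :=
    UM_acyclic a nIa (h x) (valued_map h rU Ux) dhx.
  exact: right_ideal_scaled.
move=> v [w' [Vv aw' hE]].
have [w [Uw w'E]] : exists w, valued U w /\ w' = ralg a *: w.
  have /choice[f fP] b : exists u,
      [/\ U u, fcoef w' b = ralg a * u & b \notin supp w' -> u = 0].
    have [bx|bx] := boolP (b \in supp w').
      by have [u [Uu ->]] := aw' b; exists u.
    by exists 0; rewrite mulr0 notin_supp //; split=> //; case: rU.
  have ffin : exists s : seq B, forall b, b \notin s -> f b = 0.
    by exists (supp w') => b bw; case: (fP b) => _ _; apply.
  exists (Free ffin : L); split=> [b|]; first by case: (fP b).
  by apply: fcoef_ext => b; case: (fP b).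
have dhE : d (h x) = d v + ralg a *: d w.
  rewrite -[LHS]dp -[p (h x)](subrK (d y)) hE w'E !linearD dd addr0.
  by rewrite linearZ.
(* Modulo [V] this is the kernel of [a] on [U / V], acyclic by induction. It contains the cycle
   [p x - d w], because [a (p x)] and [a (d w)] both agree with [d (h x)] modulo [V]. *)
have rW := right_ideal_cap rU (right_ideal_colon a rV).
have VW b : V b -> U b /\ colon V a b.
  move=> Vb; split; first exact: VU.
  by rewrite /colon alg_central; case: rV => _ _; apply.
have W_acyclic : acyclic_quotient (fun b => U b /\ colon V a b) V.
  by apply: (IHc _ _ a) => // [s Is u [Uu _]|u []//]; apply: Is.
have [||z [Wz Vz]] := W_acyclic (p x - d w).
- move=> b; split; first by apply: valuedB => //; apply: valued_map.
  have: valued V (ralg a *: (p x - d w)).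
    rewrite scalerBr -[_ - _](subrK (d v)).
    apply: valuedD => //; last exact: valued_map.
    by rewrite -addrA -opprD [_ + d v]addrC -dhE.
  by apply.
- by rewrite linearB dp dd subr0.
exists (w + z); split; first by apply: valuedD => // b; case: (Wz b).
by move: Vz; rewrite linearB pp pd linearD opprD addrA.
Qed.

End NoetherianInduction.

(** * Purity of the complex *)

Section Purity.
Variables (R : comPzRingType) (A : algebra R) (B : choiceType).
Local Notation L := (free_module A B).
Local Notation End := {linear L -> L}.
Variables (d p : End).

(** Take for [U] the right ideal generated by the coordinates of [k], and [V = 0]. The solution [y]
    of [p k = d y] then has coordinates that are right combinations of those of [k], and the matrix
    [m] of these combinations defines [h] with [h k = y]. *)
Lemma pure_acyclic_fibres : diff_retract d p -> noetherian R ->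
  (forall q, fibre_contractible d p q) -> pure_acyclic d p.
Proof.
move=> dpP Rnoeth fibres k dk.
pose U (a : A) := exists m : B -> A, a = \sum_(b <- supp k) fcoef k b * m b.
have rU : right_ideal U.
  split=> [|_ _ [m ->] [n ->]|_ a [m ->]].
  - by exists (fun=> 0); rewrite big1 // => b _; rewrite mulr0.
  - exists (fun b => m b + n b); rewrite -big_split; apply: eq_bigr => b _.
    by rewrite mulrDr.
  - exists (fun b => m b * a); rewrite mulr_suml; apply: eq_bigr => b _.
    by rewrite mulrA.
have r0 : right_ideal (eq^~ 0 : A -> Prop).
  by split=> // [a b -> ->|a b ->]; rewrite ?addr0 ?mul0r.
have U0 a : a = 0 -> U a by move=> ->; case: rU.
have [||y [Uy py]] := acyclic_quotient_all dpP Rnoeth fibres rU r0 U0 (x := k).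
- move=> b; have [bk|bk] := boolP (b \in supp k); last by apply/U0/notin_supp.
  exists (fun c => (c == b)%:R).
  rewrite (bigD1_seq b) ?supp_uniq //= eqxx mulr1.
  by rewrite big1 ?addr0 // => c /negPf ->; rewrite mulr0.
- by rewrite dk.
have /choice[m mP] := Uy.
pose F b : L := \sum_(c <- supp y) m c b *: delta c.
pose h : End := free_lift F; have hk : h k = y.
  rewrite [RHS](free_sum (supp_uniq y) (@notin_supp _ _ y)) /h /= /free_lift /F.
  transitivity
    (\sum_(b <- supp k) \sum_(c <- supp y) fcoef k b *: (m c b *: delta c)).
    by apply: eq_bigr => b _; apply: scaler_sumr.
  rewrite exchange_big; apply: eq_bigr => c _ /=.
  by rewrite [in RHS]mP scaler_suml; apply: eq_bigr => b _; rewrite scalerA.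
by exists h; rewrite hk; apply/subr0_eq/fcoef_ext => b; apply: py.
Qed.

End Purity.

(** * The free module on the homogeneous elements of a complex *)

Section Total.
Variables (A : pzRingType) (X : complex A).
Hypothesis X_proj : forall i, projective (X i).

Definition homogeneous := {i : int & X i}.
HB.instance Definition _ := Choice.on homogeneous.

Local Notation L := (free_module A homogeneous).

Definition homog i (x : X i) : homogeneous := Tagged (fun i => X i : Type) x.

(** The default of [tagged_as] is 0, the value in all degrees other than [i]. *)
Definition component i (b : homogeneous) : X i :=
  tagged_as (Tagged (fun i => X i : Type) (0 : X i)) b.

Lemma component_homog i x : component i (homog x) = x.
Proof. exact: (@tagged_asE _ _ (existT _ i (0 : X i)) x). Qed.

Lemma component_neq i (b : homogeneous) : tag b != i -> component i b = 0.
Proof.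
by rewrite /component /tagged_as => bi; case: eqP => //= e; case/eqP: bi.
Qed.

Definition eval i : {linear L -> X i} := free_lift (component i).

Lemma eval_delta i b : eval i (delta b) = component i b.
Proof. exact: free_lift_delta. Qed.

Definition degree i (b : homogeneous) : Prop := tag b = i.

(** The surjection [eval i] splits since [X i] is projective; dropping the basis elements of other
    degrees keeps a splitting, because [eval i] kills them. *)
Lemma section_ex i : exists s : {linear X i -> L},
  (forall x, eval i (s x) = x) /\ forall x, supported (degree i) (s x).
Proof.
have [x|s sP] := @X_proj i _ _ (eval i) idfun.
  by exists (delta (homog x)); rewrite eval_delta component_homog.
exists (proj (degree i) \o s); split=> x; last exact: supported_proj.
rewrite -[RHS]sP /= -[LHS]/((eval i \o proj (degree i)) (s x)).
apply: eq_free => b /=; rewrite [proj _ _]free_lift_delta.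
case: asboolP => // bi.
by rewrite linear0 eval_delta component_neq //; apply/eqP.
Qed.

Definition section i : {linear X i -> L} := projT1 (cid (section_ex i)).

Lemma eval_section i x : eval i (section i x) = x.
Proof. by rewrite /section; case: cid => s /= []. Qed.
Lemma supported_section i x : supported (degree i) (section i x).
Proof. by rewrite /section; case: cid => s /= []. Qed.

Lemma eval_neq i j (x : L) : supported (degree j) x -> j != i -> eval i x = 0.
Proof.
move=> jx ji; rewrite -[RHS]/((\0 : {linear L -> X i}) x).
apply: (eq_supported _ jx) => b bj; rewrite -bj in ji.
by rewrite eval_delta component_neq.
Qed.

(** With [e] and [s] the sums over all degrees of [eval] and [section], [total_diff] is [s d e] and
    [total_proj] is the idempotent [s e]. *)
Definition total_diff : {linear L -> L} :=
  free_lift (fun b => section _ (diff X _ (tagged b))).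
Definition total_proj : {linear L -> L} :=
  free_lift (fun b => section _ (tagged b)).

Lemma total_diffE i x : supported (degree i) x ->
  total_diff x = section (i + 1) (diff X i (eval i x)).
Proof.
move=> ix; rewrite -[RHS]/((section (i + 1) \o diff X i \o eval i) x).
apply: (eq_supported _ ix) => -[j y] /= ji; case: i / ji {ix}.
by rewrite [LHS]free_lift_delta eval_delta component_homog.
Qed.

Lemma total_projE i x :
  supported (degree i) x -> total_proj x = section i (eval i x).
Proof.
move=> ix; rewrite -[RHS]/((section i \o eval i) x).
apply: (eq_supported _ ix) => -[j y] /= ji; case: i / ji {ix}.
by rewrite [LHS]free_lift_delta eval_delta component_homog.
Qed.

Lemma total_diff_section i x :
  total_diff (section i x) = section (i + 1) (diff X i x).
Proof. by rewrite (total_diffE (supported_section x)) eval_section. Qed.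
Lemma total_proj_section i x : total_proj (section i x) = section i x.
Proof. by rewrite (total_projE (supported_section x)) eval_section. Qed.

Lemma eval_total_diff i x : eval (i + 1) (total_diff x) = diff X i (eval i x).
Proof.
apply: (eq_free (f := eval (i + 1) \o total_diff)
  (g := diff X i \o eval i)) => b /=.
rewrite eval_delta [total_diff _]free_lift_delta.
have [<-|bi] := eqVneq (tag b) i.
  by case: b => j y /=; rewrite eval_section component_homog.
rewrite component_neq // linear0 (eval_neq (supported_section _)) //.
by apply: contra_neq bi => /addIr.
Qed.

Lemma total_diff_retract : diff_retract total_diff total_proj.
Proof.
have deltaE (f g : {linear L -> L}) :
    (forall i x, f (delta (@homog i x)) = g (delta (homog x))) ->
    forall x, f x = g x.
  by move=> fg; apply: eq_free => -[i x]; apply: fg.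
have dE i x : total_diff (delta (@homog i x)) = section (i + 1) (diff X i x).
  exact: free_lift_delta.
have pE i x : total_proj (delta (@homog i x)) = section i x.
  exact: free_lift_delta.
split=> [x|x|x|x].
- apply: (deltaE (total_diff \o total_diff) \0) => i {}x /=.
  by rewrite dE total_diff_section diff_diff linear0.
- apply: (deltaE (total_diff \o total_proj)) => i {}x /=.
  by rewrite pE total_diff_section dE.
- apply: (deltaE (total_proj \o total_diff)) => i {}x /=.
  by rewrite dE total_proj_section.
- apply: (deltaE (total_proj \o total_proj)) => i {}x /=.
  by rewrite pE total_proj_section.
Qed.

Lemma eval_total_proj i x : eval i (total_proj x) = eval i x.
Proof.
apply: (eq_free (f := eval i \o total_proj)) => b /=.
rewrite eval_delta [total_proj _]free_lift_delta.
have [<-|bi] := eqVneq (tag b) i.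
  by case: b => j y /=; rewrite eval_section component_homog.
by rewrite component_neq // (eval_neq (supported_section _)).
Qed.

Lemma total_proj_coef x c :
  fcoef (total_proj x) c = fcoef (section (tag c) (eval (tag c) x)) c.
Proof.
apply: (@free_ind _ _ (fun x => fcoef (total_proj x) c =
  fcoef (section (tag c) (eval (tag c) x)) c) xpredT)
  => // [|b _|a {}x IHx|{}x y IHx IHy].
- by rewrite !linear0.
- rewrite eval_delta [total_proj _]free_lift_delta.
  have [<-|bc] := eqVneq (tag b) (tag c).
    by case: b => j y; rewrite component_homog.
  rewrite component_neq // linear0 (supported_section (i := tag b)) // => cb.
  by rewrite /degree in cb; rewrite cb eqxx in bc.
- by rewrite !linearZ !fcoefZ IHx.
- by rewrite !linearD !fcoefD IHx IHy.
Qed.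

(** Although [H] may mix degrees, [eval i] after [section (i + 1)] extracts its part of degree
    -1. *)
Lemma contractible_total (H : {linear L -> L}) :
  (forall x, total_diff (H x) + H (total_diff x) = total_proj x) ->
  contractible X.
Proof.
move=> HP; exists (fun i => eval i \o H \o section (i + 1)) => i x /=.
rewrite -eval_total_diff -total_diff_section -linearD HP total_proj_section.
by rewrite eval_section.
Qed.

End Total.

(** * Fibres *)

Lemma fraction_numden (D : idomainType) (c : {fraction D}) :
  exists n d : D, d != 0 /\ tofrac d * c = tofrac n.
Proof.
elim/quotW: c => x; exists \n_x, \d_x; split; first exact: denom_ratioP.
rewrite -[LHS]/(FracField.mul (tofrac \d_x) (\pi x)) !piE; apply/eqP.
rewrite FracField.equivf_def.
rewrite /FracField.mulf !numden_Ratio ?mulf_neq0 ?oner_neq0 ?denom_ratioP //.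
by rewrite mul1r mulr1 mulrC.
Qed.

Section ResidueField.
Variables (R : comPzRingType) (q : spec R).

Lemma spec_quotP (r : R) :
  (\pi_{ideal_quot spec_prime_idealr q} (r : spec_ring q) == 0 :> spec_quot q)
  = (r \in spec_pred q).
Proof.
transitivity ((r : spec_ring q) - 0 \in spec_prime_idealr q); last first.
  by rewrite subr0.
by rewrite Quotient.idealrBE; congr (_ == _); rewrite rmorph0.
Qed.

Lemma to_residue_field_eq0 (r : R) :
  (to_residue_field q r == 0) = (r \in spec_pred q).
Proof. by rewrite -spec_quotP; apply: tofrac_eq0. Qed.

Lemma residue_field_numden (c : residue_field q) : exists n d : R,
  d \notin spec_pred q /\ to_residue_field q d * c = to_residue_field q n.
Proof.
have [n [d [d0 dc]]] := fraction_numden c.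
exists (repr n), (repr d); split; last by rewrite /to_residue_field !reprK.
by rewrite -spec_quotP reprK.
Qed.

End ResidueField.

Lemma dual_basis (R : comPzRingType) (P : lmodType R) :
  fin_gen P -> projective P ->
  exists (n : nat) (e : 'I_n -> P) (f : {linear P -> {ffun 'I_n -> R^o}}),
    forall x, x = \sum_i (f x i : R) *: e i.
Proof.
move=> [n [e eP]] P_proj; exists n, e.
pose g (c : {ffun 'I_n -> R^o}) : P := \sum_i (c i : R) *: e i.
have g_lin : linear g.
  move=> a c c'; rewrite /g scaler_sumr -big_split; apply: eq_bigr => i _ /=.
  by rewrite !ffunE scalerDl scalerA.
pose gM := GRing.isLinear.Build R {ffun 'I_n -> R^o} P *:%R g g_lin.
pose gL : {linear {ffun 'I_n -> R^o} -> P} := HB.pack g gM.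
have [x|f fP] := P_proj _ _ gL idfun.
  have [c ->] := eP x; exists [ffun i => c i].
  by apply: eq_bigr => i _; rewrite ffunE.
by exists f => x; rewrite -[LHS]fP.
Qed.

Section BaseChangeUnit.
Variables (R : comPzRingType) (A K : algebra R).
Local Notation incl := (@base_change_incl R A K).

Definition bc_unit (M : lmodType A) :
    {linear M -> restrict incl (base_change K M)} :=
  base_change_unit (idfun : {linear base_change K M -> base_change K M}).

Lemma bc_unitE (M : lmodType A) (x : M) :
  bc_unit M x = tpure x (1 : K^o) :> base_change K M.
Proof. by []. Qed.

Lemma bc_unitZ (M : lmodType A) a (x : M) :
  bc_unit M (a *: x) = incl a *: (bc_unit M x : base_change K M)
    :> base_change K M.
Proof. exact: linearZ. Qed.

Lemma tens_map_unit (M N : lmodType A) (f : {linear M -> N}) (x : M) :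
  tens_map f (bc_unit M x : base_change K M) = bc_unit N (f x)
    :> base_change K N.
Proof. exact: tens_map_pure. Qed.

End BaseChangeUnit.

Section Fibre.
Variables (R : comPzRingType) (A : algebra R) (q : spec R).
Local Notation K := (residue_alg q).
Local Notation incl := (@base_change_incl R A K).
Local Notation ralg := (alg_str A).
Local Notation unit M := (@bc_unit R A K M).

(** Denominators are cleared on pure tensors; for sums they are multiplied, and primality keeps the
    product outside [q]. *)
Lemma bc_numden (M : lmodType A) (z : base_change K M) : exists (r : R) (x : M),
  r \notin spec_pred q /\ incl (ralg r) *: z = unit M x.
Proof.
elim/tpure_ind: z => [|m c|y z [r [x [rq rx]]] [s [x' [sq sx]]]].
- by exists 1, 0; rewrite scaler0 linear0; split=> //; apply: spec1.
- have [n [d [dq dc]]] := residue_field_numden c.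
  exists d, (ralg n *: m); split => //.
  rewrite [LHS]apureZ scale1r tpureZ bc_unitE tpureZ.
  by congr tpure; rewrite [LHS]dc [RHS]mulr1.
- exists (r * s), (ralg s *: x + ralg r *: x'); split.
    by apply/negP => /(@specM R q) /orP[]; apply/negP.
  rewrite [LHS]scalerDr [unit M _]linearD !bc_unitZ -rx -sx !scalerA -!rmorphM.
  by rewrite [(s * r)%R]mulrC.
Qed.

(** The functional [f] extends to the fibre, with values in the residue field, by sending the tensor
    of [m] and [c] to [f m * c]. *)
Lemma bc_unit_eq0 (M : lmodType A) (x : M) (f : M -> R) :
  {morph f : y z / y + z} -> (forall r y, f (ralg r *: y) = r * f y) ->
  unit M x = 0 -> f x \in spec_pred q.
Proof.
move=> fD fZ x0; rewrite -to_residue_field_eq0.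
pose g (m : M) (c : K^o) : residue_field q := to_residue_field q (f m) * c.
have g_bal : tbalanced g.
  split=> [m m' c|m c c'|r m c].
  - by rewrite /g fD rmorphD mulrDl.
  - by rewrite /g mulrDr.
  - by rewrite /g [r *: m]/(ralg r *: (m : M)) fZ rmorphM mulrCA mulrA.
have := tlift_pure x (1 : K^o) g_bal.
rewrite -bc_unitE x0 tlift0 // => /esym/eqP.
by rewrite /g mulr1.
Qed.

Lemma in_extension_coords n (e : 'I_n -> alg_mod A)
    (f : {linear alg_mod A -> {ffun 'I_n -> R^o}}) (a : A) :
  (forall x, x = \sum_i (f x i : R) *: e i) ->
  (forall i, (f a i : R) \in spec_pred q) -> in_extension q a.
Proof.
by move=> ef fq; exists n, (fun i => f a i), e; split=> //; apply: ef.
Qed.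

Variables (X : complex A) (X_proj : forall i, projective (X i)).
Hypothesis (A_fg : fin_gen (alg_mod A)) (A_proj : projective (alg_mod A)).
Local Notation L := (free_module A (homogeneous X)).

(** After clearing denominators on a finite list, the fibre contraction lifts to [L]. The error of
    the lift vanishes in the fibre, and a dual basis of [A] over [R] turns this into coordinates in
    [q A]. *)
Lemma fibre_contractible_total : contractible (base_change_complex K X) ->
  fibre_contractible (total_diff X_proj) (total_proj X_proj) q.
Proof.
move=> [h hP] s.
pose d := total_diff X_proj; pose p := total_proj X_proj.
have hP' i (x : X (i + 1)) : unit _ x =
    tens_map (diff X i) (h i (unit _ x)) +
    h (i + 1) (unit _ (diff X (i + 1) x)).
  by rewrite -tens_map_unit; apply: hP.
have evalZ i a (z : L) : eval X i (a *: z) = a *: eval X i z by exact: linearZ.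
(* The lift is evaluated both at [b] and at [d b]. *)
pose s' := s ++ image_supp d s.
pose good (r : R) b (z : L) := forall i, unit _ (eval X i z) =
  h i (unit _ (eval X (i + 1) (ralg r *: delta b))).
have good_ex b : exists r z, r \notin spec_pred q /\ good r b z.
  case: b => j x.
  have [i ji] : exists i, j = i + 1 by exists (j - 1); rewrite subrK.
  subst j; have [r [y [rq ry]]] := bc_numden (h i (unit _ x)).
  (* The lift sits in the single degree [i], one below that of the basis element; in other degrees
     both sides of [good] vanish. *)
  exists r, (section X_proj i y); split=> // j; have [->|ji] := eqVneq j i.
    rewrite eval_section -ry evalZ eval_delta component_homog.
    rewrite bc_unitZ [RHS]linearZ; reflexivity.
  rewrite (eval_neq (supported_section X_proj y)) 1?eq_sym //.
  have -> : eval X (j + 1) (ralg r *: delta (homog x)) = 0.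
    rewrite linearZ eval_delta component_neq /= ?scaler0 //.
    by apply/eqP => /addIr ij; rewrite ij eqxx in ji.
  by rewrite !linear0.
have good_mul r t b z : good r b z -> good (t * r) b (ralg t *: z).
  move=> zP i; rewrite rmorphM -scalerA evalZ [in RHS]evalZ.
  rewrite !bc_unitZ [RHS]linearZ; congr (_ *: _); exact: zP.
have [r [rq /choice[F FP]]] : exists r, r \notin spec_pred q /\
    forall b, exists z, b \in s' -> good r b z.
  elim: s' => [|b s' [r [rq IHr]]].
    by exists 1; split=> [|b]; [apply: spec1 | exists 0].
  have [t [z [tq zP]]] := good_ex b; exists (t * r); split.
    by apply/negP => /(@specM R q) /orP[]; apply/negP.
  move=> c; have [->|cb] := eqVneq c b.
    by exists (ralg r *: z); rewrite mulrC => _; apply: good_mul.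
  have [y yP] := IHr c; exists (ralg t *: y); rewrite inE (negPf cb) => cs'.
  exact/good_mul/yP.
pose H := free_lift F : {linear L -> L}.
have HP z i : supported [eta mem s'] z ->
    unit _ (eval X i (H z)) = h i (unit _ (eval X (i + 1) (ralg r *: z))).
  pose f1 := unit _ \o eval X i \o H.
  pose f2 := restrict_map (h i) \o unit _ \o eval X (i + 1) \o central_scale r.
  move=> sz; rewrite -[LHS]/(f1 z) -[RHS]/(f2 z).
  apply: (eq_supported _ sz) => b bs.
  rewrite /f1 /f2 /= [H _]free_lift_delta; exact: FP.
exists (p \o H), r; split=> // b c bs.
set W := _ - _.
have [_ _ pd pp] := total_diff_retract X_proj.
have pW : W = p W by rewrite /W /= !linearB linearZ /= !pp pd.
have [n [e [f ef]]] := dual_basis A_fg A_proj.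
apply: (in_extension_coords ef) => k.
have -> : fcoef W c = fcoef (section X_proj (tag c) (eval X (tag c) W)) c.
  by rewrite {1}pW total_proj_coef.
have [i ->] : exists i, tag c = i + 1 by exists (tag c - 1); rewrite subrK.
pose g x : alg_mod A := fcoef (section X_proj (i + 1) x) c.
(* Each coordinate is an [R]-linear functional on [X (i + 1)], so it suffices that the part of [W]
   in that degree dies in the fibre. *)
apply: (bc_unit_eq0 (f := fun x => f (g x) k : R)).
- by move=> x z; rewrite /g linearD fcoefD linearD ffunE.
- move=> t x; rewrite /g linearZ fcoefZ.
  by rewrite -[ralg t * _]/(t *: g x) linearZ ffunE.
set x := eval X (i + 1) (delta b).
have -> : eval X (i + 1) W =
    ralg r *: x - diff X i (eval X i (H (delta b)))
    - eval X (i + 1) (H (d (delta b))).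
  rewrite /W !linearB /= !eval_total_proj eval_total_diff eval_total_proj.
  by rewrite evalZ eval_total_proj.
have xE : unit _ (ralg r *: x) = unit _ (diff X i (eval X i (H (delta b)))) +
    unit _ (eval X (i + 1) (H (d (delta b)))).
  have sb : supported [eta mem s'] (delta b : L).
    by apply: supported_delta; rewrite /= mem_cat bs.
  have sdb : supported [eta mem s'] (d (delta b)).
    have: supported [eta mem s] (delta b : L) by apply: supported_delta.
    move=> /(supported_image_supp (f := d)); apply: sub_supported => b' b'P.
    by rewrite /s' /= mem_cat; apply/orP; right.
  rewrite -tens_map_unit (HP _ _ sb) (HP _ _ sdb).
  rewrite !evalZ eval_total_diff -/x.
  have dZ : diff X (i + 1) (ralg r *: x) = ralg r *: diff X (i + 1) x.
    by rewrite linearZ.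
  rewrite -dZ; exact: hP'.
by rewrite !linearB xE addrAC addrK subrr.
Qed.

End Fibre.

Lemma base_change_contractible (R : comPzRingType) (A K : algebra R)
    (X : complex A) :
  contractible X -> contractible (base_change_complex K X).
Proof.
move=> [h hP]; exists (fun i => tens_map (h i)) => i.
elim/tpure_ind => [|x c|x y IHx IHy]; first by rewrite !linear0 addr0.
  rewrite /= !tens_map_pure -tpureDl; congr tpure; exact: hP.
by rewrite /= in IHx IHy *; rewrite !linearD addrACA -IHx -IHy.
Qed.

Theorem proposition3p6 (R : comPzRingType) (A : algebra R) :
  noetherian R -> frobenius A ->
  forall X : KProj A, in_KProj_rel X ->
    (KProj_zero X <->
     forall p : spec R, KProj_zero (base_change_KProj (residue_alg p) X)).
Proof.
move=> Rnoeth [A_fg A_proj _] X _; split=> [X0 q|fibres].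
  exact: base_change_contractible X0.
have X_proj := @KProj_projective _ X.
have dpP := total_diff_retract X_proj.
have [H HP] : exists H : {linear free_module A _ -> free_module A _}, forall x,
    total_diff X_proj (H x) + H (total_diff X_proj x) = total_proj X_proj x.
  apply: pure_acyclic_contractible => //; apply: pure_acyclic_fibres => // q.
  exact: fibre_contractible_total (fibres q).
exact: contractible_total HP.
Qed.
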